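(* For every positive integer $n$ the following four inequalities hold: $$g_1(n|_2) \leq \lceil \log_3 n \rceil + \lceil \log_3(n/5) \rceil + 1,$$ $$g_1(n|_3) \leq \lceil \log_3 n \rceil + \lceil \log_3(n/4) \rceil + \lceil \log_3(n/6) \rceil + 2,$$ $$g_1(n|_4) \leq \lceil \log_3 n \rceil + \lceil \log_3(n/5) \rceil + \lceil \log_3(n/11) \rceil + \lceil \log_3(n/20) \rceil + 5,$$ $$g_1(n|_5) \leq \lceil \log_3 n \rceil + \lceil \log_3(n/7) \rceil + \lceil \log_3(n/11) \rceil + \lceil \log_3(n/13) \rceil + \lceil \log_3(n/17) \rceil + 7.$$
   Context: Let $S_1,\dots,S_m$ be pairwise disjoint finite sets of coins with $|S_i|=n_i\ge 1$. Each $S_i$ contains exactly one counterfeit coin. All normal coins have the same weight, and all counterfeit coins have the same weight, heavier than that of a normal coin. The unknown configuration is thus an element $X$ of $S_1\times\cdots\times S_m$ (identified with the set of its $m$ counterfeit coins). A weighing $L:R$ on a balance consists of two subsets $L,R\subset \bigcup_{i=1}^m S_i$ with $|L|=|R|$ (coins from different $S_i$ may be mixed), and its outcome is $\operatorname{sgn}(|L\cap X|-|R\cap X|)\in\{+,0,-\}$. A search algorithm is adaptive: each weighing may depend on the outcomes of all previous weighings. Define $g_1(n_1,\dots,n_m)$ to be the least number $t$ such that some adaptive algorithm using at most $t$ weighings always identifies all $m$ counterfeit coins, i.e. the sequence of outcomes determines $X\in S_1\times\cdots\times S_m$ uniquely. When $n_1=\cdots=n_m=n$, write $g_1(n|_m)$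 for $g_1(n_1,\dots,n_m)$. $\lceil x\rceil$ denotes the least integer not less than the real number $x$ (it may be negative). *)

(* Defs.v *)
From mathcomp Require Import all_boot all_order all_algebra.
From mathcomp Require Import boolp reals exp.

Set Implicit Arguments.
Unset Strict Implicit.
Unset Printing Implicit Defensive.

Import GRing.Theory Num.Theory.

Local Open Scope ring_scope.

Section Coins.
Variables (m : nat) (n : 'I_m -> nat).

(* The disjoint union of S_0, ..., S_(m-1): [Tagged _ k] with tag i is the
   k-th coin of S_i, and |S_i| = n i. *)
Definition coin : finType := {i : 'I_m & 'I_(n i)}.

Definition config : Type := {dffun forall i : 'I_m, 'I_(n i)}.

Definition counterfeits (X : config) : {set coin} :=
  [set c | X (tag c) == tagged c].

Record weighing := Weighing {
  left_pan : {set coin};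
  right_pan : {set coin};
  card_pans : #|left_pan| = #|right_pan| }.

Definition outcome (w : weighing) (X : config) : int :=
  sgz (#|left_pan w :&: counterfeits X|%:Z
       - #|right_pan w :&: counterfeits X|%:Z).

(* An adaptive algorithm is a decision tree; only the branches of index
   1, 0 and -1 are ever taken. *)
Inductive algorithm :=
  | Stop
  | Weigh of weighing & (int -> algorithm).

Fixpoint outcomes (a : algorithm) (X : config) : seq int :=
  if a is Weigh w next then outcome w X :: outcomes (next (outcome w X)) X
  else [::].

Definition identifies_within (t : nat) (a : algorithm) : Prop :=
  (forall X, (size (outcomes a X) <= t)%N) /\ injective (outcomes a).

Definition solvable_within (t : nat) : Prop :=
  exists a, identifies_within t a.

Fixpoint nonadaptive (s : seq weighing) : algorithm :=
  if s is w :: s' then Weigh w (fun=> nonadaptive s') else Stop.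

Lemma outcomes_nonadaptive s X :
  outcomes (nonadaptive s) X = [seq outcome w X | w <- s].
Proof. by elim: s => //= w s ->. Qed.

Lemma card_pans1 (c d : coin) : #|[set c]| = #|[set d]|.
Proof. by rewrite !cards1. Qed.

Definition weigh1 (p : coin * coin) := Weighing (card_pans1 p.1 p.2).

Lemma card_set1I (c : coin) (X : config) :
  #|[set c] :&: counterfeits X| = (X (tag c) == tagged c) :> nat.
Proof.
case: eqP => [Xc | /eqP Xc].
  by rewrite (setIidPl _) ?cards1 // sub1set inE Xc.
by apply/eqP; rewrite cards_eq0 setI_eq0 disjoints1 inE.
Qed.

(* Comparing all pairs of coins identifies the configuration. *)
Lemma solvable_ex : exists t, `[< solvable_within t >].
Proof.
pose s := [seq weigh1 p | p <- enum {: coin * coin}].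
exists (size s); apply/asboolP; exists (nonadaptive s); split=> [X | X Y].
  by rewrite outcomes_nonadaptive size_map.
rewrite !outcomes_nonadaptive /s -[LHS]map_comp -[RHS]map_comp => /eq_in_map eqXY.
apply/ffunP => i; apply/eqP; case: eqVneq => // neqXY.
pose p : coin * coin := (Tagged _ (X i), Tagged _ (Y i)).
have := eqXY p; rewrite mem_enum => /(_ isT).
rewrite /= /outcome /= !card_set1I /= !eqxx eq_sym.
by rewrite eq_sym in neqXY; rewrite (negPf neqXY).
Qed.

Definition g1 : nat := ex_minn solvable_ex.

End Coins.

Definition g1_const (m n : nat) : nat := g1 (fun _ : 'I_m => n).

Definition log3 (R : realType) (x : R) : R := ln x / ln 3.

(* Main.v *)
(** Two moves produce all the upper bounds.

First, weighing each [S_i] against itself in three nearly equal parts costs [m]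
weighings and divides [n] by 3.  It uses equally many coins of [S_i] on both
pans, and the coins it discards are genuine, so that the remaining parts can be
padded to any common size [b] with [b <= n <= 3 ^ k * b].  Hence
[g1(n|_m) <= g1(b|_m) + k m], and only finitely many [b] matter.

Second, for those [b], mixing coins of different sets beats the separate
strategy.  A position of the search is a union of boxes, products of blocks of
coins; a weighing cuts every block into the parts on the left pan, off the
balance and on the right pan, and sorts the resulting boxes into three smaller
positions.  A directed acyclic graph of positions, found by computer search, is
checked by evaluation.  Its economical positions are the boxes of sizes
(2,2,2), (5,5), (2,13), (4,20), (2,11,11) and (7,7,7,7,7), solved in 2, 3, 3, 4,
5 and 9 weighings: for instance 20 = 5 * 4 reduces four sets of 20 coins to
(5,5), (4,20) and (4,20), hence to 3 + 4 + 4 = 11 weighings.  For five sets of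
17 coins, two weighings on two of the sets leave a position with the structure
of a box (3,11) or (5,5); doing this twice leads, in the critical case, to
(11,11,17), that is to (2,11,11) followed by 9 = 3 ^ 2 coins. *)

Require Import Defs.
From mathcomp Require Import all_boot all_order all_algebra.
From mathcomp Require Import boolp reals exp.
From mathcomp Require Import zify lra.

Set Implicit Arguments.
Unset Strict Implicit.
Unset Printing Implicit Defensive.

(** * Disjoint families of finite sets *)

Lemma uniq_flatten_nth (T : eqType) (ss : seq (seq T)) k :
  uniq (flatten ss) -> uniq (nth [::] ss k).
Proof.
elim: ss k => [|s ss IHss] [|k] //=; rewrite cat_uniq => /and3P[us _ uss] //.
exact: IHss.
Qed.

Lemma mem_flatten_nth (T : eqType) (ss : seq (seq T)) k x :
  x \in nth [::] ss k -> x \in flatten ss.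
Proof.
move=> xk; apply/flattenP; exists (nth [::] ss k) => //.
by rewrite mem_nth // ltnNge; apply: contraTN xk => /(nth_default [::])->.
Qed.

(** When [ss] regroups pieces into blocks, this makes distinct blocks disjoint. *)
Lemma uniq_flatten_inj (T : eqType) (ss : seq (seq T)) j k x :
  uniq (flatten ss) -> x \in nth [::] ss j -> x \in nth [::] ss k -> j = k.
Proof.
elim: ss j k => [|s ss IHss] [|j] [|k] //=; rewrite cat_uniq.
all: case/and3P=> _ /hasPn dss uss.
- by move=> xs /mem_flatten_nth/dss/negP; case.
- by move=> /mem_flatten_nth/dss/negP xN xs; case: xN.
by move=> xj xk; congr _.+1; apply: IHss xk.
Qed.

Section Families.
Variable T : finType.
Implicit Types (A W : {set T}) (F B C : nat -> {set T}) (s : seq nat).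

Lemma in_bigcup_seq F s x :
  (x \in \bigcup_(i <- s) F i) = has (fun i => x \in F i) s.
Proof.
by elim: s => [|i s IHs]; rewrite ?big_nil ?big_cons ?inE //= IHs.
Qed.

(** Indices are plain naturals restricted to a list, because block labels and pieces come from
    computed lists of numbers. *)
Definition disjoint_on s F :=
  {in s &, forall i j, i != j -> [disjoint F i & F j]}.

Lemma disjoint_on_eq s F i j x :
  disjoint_on s F -> i \in s -> j \in s -> x \in F i -> x \in F j -> i = j.
Proof.
move=> dF si sj Fi Fj; apply/eqP; apply: contraT => /(dF _ _ si sj).
by move/disjoint_setI0/setP/(_ x); rewrite !inE Fi Fj.
Qed.

Lemma disjoint_onP s F :
  (forall i j x, i \in s -> j \in s -> x \in F i -> x \in F j -> i = j) ->
  disjoint_on s F.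
Proof.
move=> eqF i j si sj; apply: contraR; rewrite -setI_eq0.
by case/set0Pn=> x /setIP[Fi Fj]; apply/eqP/(eqF _ _ x).
Qed.

Lemma card_bigcup_seq F s :
  uniq s -> disjoint_on s F ->
  #|\bigcup_(i <- s) F i| = \sum_(i <- s) #|F i|.
Proof.
elim: s => [|i s IHs]; first by rewrite !big_nil cards0.
rewrite !big_cons /= => /andP[Ni us] dF.
have dFs : disjoint_on s F by move=> j k sj sk; apply: dF; rewrite inE ?sj ?sk orbT.
rewrite cardsU IHs // [_ :&: _](_ : _ = set0) ?cards0 ?subn0 //.
apply/setP => x; rewrite in_setI in_bigcup_seq inE; apply/negbTE/negP.
case/andP => Fix /hasP[j sj Fjx]; case/negP: Ni.
by rewrite (disjoint_on_eq dF _ _ Fix Fjx) ?inE ?eqxx ?sj ?orbT.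
Qed.

(** Greedy filling. While some [B j] is below its target, the blocks together have fewer elements
    than [W], so an element of [W] lies in none of them and can be added to [B j]. *)
Lemma pad_family W s (sz : nat -> nat) B :
  uniq s -> \sum_(j <- s) sz j <= #|W| -> {in s, forall j, B j \subset W} ->
  disjoint_on s B -> {in s, forall j, #|B j| <= sz j} ->
  exists C, [/\ {in s, forall j, B j \subset C j},
    {in s, forall j, C j \subset W}, disjoint_on s C &
    {in s, forall j, #|C j| = sz j}].
Proof.
(* The induction is on the total deficit, which each added element lowers by one. *)
move=> us leW; have [d] := ubnP (\sum_(j <- s) (sz j - #|B j|)).
elim: d B => // d IHd B ltd BW dB Bsz.
have [/hasP[j sj ltj]|/hasPn geB] := boolP (has (fun j => #|B j| < sz j) s); last first.
  exists B; split=> // j sj; apply/eqP; rewrite eqn_leq Bsz //= leqNgt.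
  exact: geB.
have sumD1 (f : nat -> nat) :
    \sum_(i <- s) f i = f j + \sum_(i <- s | i != j) f i by apply: bigD1_seq.
have [c cW cB] : exists2 c, c \in W & c \notin \bigcup_(i <- s) B i.
  apply/subsetPn; apply: contraTN ltj => /subset_leq_card.
  rewrite card_bigcup_seq // -leqNgt => /(leq_trans leW).
  rewrite !sumD1.
  have : \sum_(i <- s | i != j) #|B i| <= \sum_(i <- s | i != j) sz i.
    rewrite big_seq_cond [leqRHS]big_seq_cond.
    by apply: leq_sum => i /andP[si _]; apply: Bsz.
  lia.
pose B' i := if i == j then c |: B i else B i.
have BB' i : B i \subset B' i by rewrite /B'; case: eqP => // _; apply: subsetUr.
have Nc i : i \in s -> c \notin B i.
  by move=> si; apply: contra cB => Bic; rewrite in_bigcup_seq; apply/hasP; exists i.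
have [|i si||i si|C [B'C CW dC Csz]] := IHd B'; last first.
- by exists C; split=> // i si; apply: subset_trans (B'C i si).
- rewrite /B'; case: eqP => [->|_]; last exact: Bsz.
  by rewrite cardsU1 Nc.
- apply: disjoint_onP => i k x si sk; rewrite /B'.
  have [->|_] := eqVneq i j; have [->|_] := eqVneq k j => //; rewrite ?in_setU1.
  + case/orP=> [/eqP->|]; first by move=> Bkc; case/negP: (Nc k sk).
    exact: disjoint_on_eq dB sj sk.
  + move=> Bix /orP[/eqP xc|]; first by rewrite xc (negPf (Nc i si)) in Bix.
    exact: disjoint_on_eq dB si sj Bix.
  + exact: disjoint_on_eq dB si sk.
- by rewrite /B'; case: eqP => _; rewrite ?subUset ?sub1set ?cW BW.
rewrite -ltnS; apply: leq_trans ltd; rewrite ltnS !sumD1.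
rewrite {1}/B' eqxx cardsU1 Nc //.
rewrite [X in _ + X < _](eq_bigr (fun i => sz i - #|B i|)); last first.
  by move=> i /negPf; rewrite /B' => ->.
lia.
Qed.

(** * Cutting a set into a left, an idle and a right part *)

Section Cut.
Variables (A : {set T}) (l r : nat).

(** In the enumeration of [A], the first [l] elements go left (0), the next [r] go right (2) and the
    rest stay off the balance (1); this is the order of the pieces [3 * j], [3 * j + 1],
    [3 * j + 2]. *)
Definition cut_index (x : T) : nat :=
  if x \in take l (enum A) then 0
  else if x \in take r (drop l (enum A)) then 2 else 1.

Definition cut (k : nat) : {set T} := [set x in A | cut_index x == k].

Lemma cut_index_lt x : cut_index x < 3.
Proof. by rewrite /cut_index; do 2?case: ifP. Qed.

Hypothesis lrA : l + r <= #|A|.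

Lemma card_cut0 : #|cut 0| = l.
Proof.
rewrite (_ : cut 0 = [set x in take l (enum A)]); last first.
  apply/setP => x; rewrite !inE /cut_index; case: ifP => [/mem_take|_].
    by rewrite mem_enum => ->.
  by case: ifP; rewrite andbF.
rewrite cardsE (card_uniqP _) ?take_uniq ?enum_uniq //.
by rewrite size_takel // -cardE; lia.
Qed.

Lemma card_cut2 : #|cut 2| = r.
Proof.
rewrite (_ : cut 2 = [set x in take r (drop l (enum A))]); last first.
  apply/setP => x; rewrite !inE /cut_index; case: ifP => [xl|_].
    rewrite andbF; apply/esym/negP => /mem_take xr.
    have := enum_uniq (mem A); rewrite -(cat_take_drop l (enum A)) cat_uniq.
    by case/and3P=> _ /hasP[]; exists x.
  case: ifP => [/mem_take/mem_drop|]; last by rewrite andbF.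
  by rewrite mem_enum => ->.
rewrite cardsE (card_uniqP _) ?take_uniq ?drop_uniq ?enum_uniq //.
by rewrite size_takel // size_drop -cardE; lia.
Qed.

Lemma card_cut1 : #|cut 1| = #|A| - (l + r).
Proof.
have -> : cut 1 = A :\: (cut 0 :|: cut 2).
  apply/setP => x; rewrite !inE; case: (x \in A); rewrite ?andbF //=.
  by case: (cut_index x) (cut_index_lt x) => [|[|[|]]].
rewrite cardsDS; last by apply/subsetP => x; rewrite !inE -andb_orr => /andP[].
rewrite cardsU card_cut0 card_cut2 [_ :&: _](_ : _ = set0) ?cards0 ?subn0 //.
by apply/setP => x; rewrite !inE; case: (x \in A); case: (cut_index x) => [|[|]].
Qed.

Lemma card_cut k : k < 3 -> #|cut k| = nth 0 [:: l; #|A| - (l + r); r] k.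
Proof.
by case: k => [|[|[|]]] //= _; rewrite (card_cut0, card_cut1, card_cut2).
Qed.

End Cut.
End Families.

(** * Positions and their verification *)

(* An entry is a position with a weighing to perform in it.  Its blocks of coins
   are labelled by the indices of [sizes]; a member of [states] lists the labels
   of the blocks that contain a counterfeit coin, so a box is a single state.
   The weighing puts [l] coins of block [j] on the left pan and [r] on the right
   one, where [(l, r)] is item [j] of [pans].  The parts of block [j] on the left
   pan, off the balance and on the right pan become the pieces [3 * j],
   [3 * j + 1] and [3 * j + 2].  For each outcome, a pair [(k, pre)] gives the
   index [k] of an earlier entry, and item [c] of [pre] lists the pieces whose
   union is the block [c] of that entry.  Genuine coins may be needed to balance
   the pans: [supply] bounds the number of coins, genuine ones included, that
   must be at hand. *)
Record entry := Entry {
  weighings : nat;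
  supply : nat;
  sizes : seq nat;
  states : seq (seq nat);
  pans : seq (nat * nat);
  heavy_left : nat * seq (seq nat);
  balance : nat * seq (seq nat);
  heavy_right : nat * seq (seq nat) }.

(** Both the leaf of the graph and the default value for [nth]. Its single empty state means that no
    counterfeit coin remains to be located. *)
Definition stop := Entry 0 0 [::] [:: [::]] [::] (0, [::]) (0, [::]) (0, [::]).

Definition labels (e : entry) : seq nat := iota 0 (size (sizes e)).
Definition pieces (e : entry) : seq nat := iota 0 (3 * size (sizes e)).

Definition piece_size (e : entry) (i : nat) : nat :=
  let: (l, r) := nth (0, 0) (pans e) (i %/ 3) in
  nth 0 [:: l; nth 0 (sizes e) (i %/ 3) - (l + r); r] (i %% 3).

(** The counterfeit coin of each marked block may be in any of its three pieces. Empty pieces are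
    skipped since they cannot contain it. *)
Fixpoint refinements (e : entry) (s : seq nat) : seq (seq nat) :=
  if s is j :: s' then
    [seq i :: s'' | i <- [seq i <- iota (3 * j) 3 | 0 < piece_size e i],
                    s'' <- refinements e s']
  else [:: [::]].

Definition pan_size (e : entry) (k : nat) : nat :=
  sumn [seq piece_size e (3 * j + k) | j <- labels e].

Definition pan_load (e : entry) (k : nat) (s : seq nat) : nat :=
  count (fun j => 3 * j + k \in s) (labels e).

(** The right load is the first argument of [cmp], so [ltn] selects the states in which the left pan
    is heavier. *)
Definition refined_states (e : entry) (cmp : rel nat) : seq (seq nat) :=
  [seq s <- flatten [seq refinements e s | s <- states e]
     | cmp (pan_load e 2 s) (pan_load e 0 s)].

(* The pieces abandoned by the next position: each consists of at most one coin,
   whose status is known once the kept pieces are resolved (last conjunct of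
   [check_child]). *)
Definition released (ss pre : seq (seq nat)) : seq nat :=
  [seq i <- undup (flatten ss) | i \notin flatten pre].

(** Released coins may be counterfeit, hence unfit as ballast: they are charged to the supply. A
    piece that is neither kept nor in any state is genuine and stays available. When [pre] is empty,
    the last conjunct forces all remaining states to mark the same pieces, so that the search may
    end. *)
Definition check_child (e e' : entry) (ss pre : seq (seq nat)) : bool :=
  let kept := flatten pre in
  let rel := released ss pre in
  [&& size pre == size (sizes e'), uniq kept,
      all (gtn (3 * size (sizes e))) kept,
      all (gtn (3 * size (sizes e))) rel,
      all (fun c => sumn [seq piece_size e i | i <- nth [::] pre c]
                      <= nth 0 (sizes e') c) (labels e') &
      all (fun i => piece_size e i <= 1) rel] &&
  [&& supply e' + size rel <= supply e,
      all (fun s => has (fun s' =>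
             all (fun c => count (mem s) (nth [::] pre c) == (c \in s'))
               (labels e')) (states e')) ss &
      all (fun s1 => all (fun s2 =>
             all (fun i => (i \in s1) == (i \in s2)) kept ==>
             all (fun i => (i \in s1) == (i \in s2)) rel) ss) ss].

(** The bound [p.1 < k] makes the graph acyclic. The truncated differences [l - r] and [r - l] count
    the genuine coins needed to level the pans. *)
Definition check_entry (db : seq entry) (k : nat) : bool :=
  let e := nth stop db k in
  let l := pan_size e 0 in
  let r := pan_size e 2 in
  let check_branch (p : nat * seq (seq nat)) cmp :=
    let e' := nth stop db p.1 in
    [&& p.1 < k, weighings e' < weighings e &
        check_child e e' (refined_states e cmp) p.2] in
  if weighings e is 0 then sizes e == [::] else
  [&& all (fun j => let: (a, b) := nth (0, 0) (pans e) j in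
             a + b <= nth 0 (sizes e) j) (labels e),
      all (all (gtn (size (sizes e)))) (states e),
      sumn (sizes e) + (l - r) <= supply e &
      sumn (sizes e) + (r - l) <= supply e] &&
  [&& check_branch (heavy_left e) ltn,
      check_branch (balance e) eq_op &
      check_branch (heavy_right e) gtn].

Definition check_table (db : seq entry) : bool :=
  all (check_entry db) (iota 0 (size db)).

(** * Soundness *)

Section Soundness.
Variables (m : nat) (n : 'I_m -> nat).
Local Notation coin := (coin n).
Local Notation config := (config n).
Implicit Types (X Y : config) (P : config -> Prop) (W : {set coin}).
Implicit Types (B C : nat -> {set coin}) (e : entry).

(** Relativises [solvable_within] to a predicate [P], the knowledge gathered so far. *)
Definition solves P t := exists a : algorithm n,
  (forall X, P X -> size (outcomes a X) <= t) /\
  (forall X Y, P X -> P Y -> outcomes a X = outcomes a Y -> X = Y).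

Lemma solves_sub P Q t : (forall X, P X -> Q X) -> solves Q t -> solves P t.
Proof.
by move=> PQ [a [szQ injQ]]; exists a; split=> [X /PQ/szQ|X Y /PQ QX /PQ QY] //; apply: injQ.
Qed.

Lemma solves_leq P t u : t <= u -> solves P t -> solves P u.
Proof. by move=> tu [a [szP injP]]; exists a; split=> // X /szP/leq_trans; apply. Qed.

(** Two configurations with equal outcome sequences agree on the first outcome, hence follow the
    same subtree, where that subtree separates them. *)
Lemma solves_weigh P (w : weighing n) t :
  (forall o, o \in [:: 1; 0; -1 : int]%R -> solves (fun X => P X /\ outcome w X = o) t) ->
  solves P t.+1.
Proof.
move=> sol; have out X : outcome w X \in [:: 1; 0; -1 : int]%R.
  by rewrite /outcome !inE; case: sgzP.
(* Subtrees are indexed by all integers; those outside 1, 0, -1 are never reached and receive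
   [Stop]. *)
have /all_sig[next nextP] : forall o : int, {a : algorithm n | o \in [:: 1; 0; -1 : int]%R ->
    (forall X, P X -> outcome w X = o -> size (outcomes a X) <= t) /\
    (forall X Y, P X -> P Y -> outcome w X = o -> outcome w Y = o ->
       outcomes a X = outcomes a Y -> X = Y)}.
  move=> o; apply: cid; have [/sol[a [sza inja]]|_] := boolP (o \in _); last by exists (Stop n).
  exists a => _; split=> [X PX oX|X Y PX PY oX oY]; first exact: sza.
  exact: inja.
exists (Weigh w next); split=> /= [X PX|X Y PX PY [oXY]]; last rewrite -oXY.
  by have [szX _] := nextP _ (out X); apply: szX.
by have [_ injX] := nextP _ (out X); apply: injX.
Qed.

(** The inclusion says that every coin of [W] outside the blocks is genuine, so that it can serve as
    ballast. *)
Definition fits W (lab : seq nat) B (ss : seq (seq nat)) X :=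
  exists2 s, s \in ss &
    {in lab, forall i, #|B i :&: counterfeits X| = (i \in s) :> nat} /\
    W :&: counterfeits X \subset \bigcup_(i <- lab) B i.

(** The released coins are outside [W]; their status can still be deduced from that of the coins in
    [W]. *)
Definition determined W P := forall X Y, P X -> P Y ->
  W :&: counterfeits X = W :&: counterfeits Y -> X = Y.

(* [W] is the set of the coins that may be put on the balance. *)
Definition valid e := forall W B P,
  supply e <= #|W| -> {in labels e, forall j, B j \subset W} ->
  disjoint_on (labels e) B ->
  {in labels e, forall j, #|B j| <= nth 0 (sizes e) j} ->
  (forall X, P X -> fits W (labels e) B (states e) X) ->
  determined W P -> solves P (weighings e).

Definition piece e B (i : nat) : {set coin} :=
  let: (l, r) := nth (0, 0) (pans e) (i %/ 3) in
  cut (B (i %/ 3)) l r (i %% 3).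

(** * Refining the blocks of a position into pieces *)

Section Refinement.
Variables (e : entry) (W : {set coin}) (B : nat -> {set coin}).
Hypothesis pansP : {in labels e, forall j, let: (a, b) := nth (0, 0) (pans e) j in
  a + b <= nth 0 (sizes e) j}.
Hypothesis BW : {in labels e, forall j, B j \subset W}.
Hypothesis dB : disjoint_on (labels e) B.
Hypothesis Bsz : {in labels e, forall j, #|B j| = nth 0 (sizes e) j}.

Lemma label_of i : i \in pieces e -> i %/ 3 \in labels e.
Proof. by rewrite !mem_iota; lia. Qed.

Lemma piece_sub i : piece e B i \subset B (i %/ 3).
Proof.
by rewrite /piece; case: nth => l r; apply/subsetP => c; rewrite inE => /andP[].
Qed.

Lemma card_piece i : i \in pieces e -> #|piece e B i| = piece_size e i.
Proof.
move=> /label_of ei; rewrite /piece /piece_size; have := pansP ei.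
by case: nth => l r lr; rewrite card_cut ?ltn_mod ?Bsz.
Qed.

Lemma piece_disjoint : disjoint_on (pieces e) (piece e B).
Proof.
apply: disjoint_onP => i k c ei ek ci ck.
have eq3 : i %/ 3 = k %/ 3.
  by apply: disjoint_on_eq dB (label_of ei) (label_of ek) _ _;
    [apply: (subsetP (piece_sub i)) ci | apply: (subsetP (piece_sub k)) ck].
move: ci ck; rewrite /piece -eq3; case: nth => l r; rewrite !inE => /andP[_ /eqP ci].
by case/andP=> _; rewrite ci => /eqP eqm; rewrite (divn_eq i 3) eq3 eqm -divn_eq.
Qed.

Lemma pieceW i : i \in pieces e -> piece e B i \subset W.
Proof. by move=> ei; apply: subset_trans (piece_sub i) (BW (label_of ei)). Qed.

Lemma piece_cover j c : j \in labels e -> c \in B j ->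
  exists2 k, k < 3 & c \in piece e B (3 * j + k).
Proof.
move=> ej Bjc; case def_lr: (nth (0, 0) (pans e) j) => [l r].
exists (cut_index (B j) l r c); first exact: cut_index_lt.
have lt3 := cut_index_lt (B j) l r c.
rewrite /piece mulnC divnMDl // divn_small // addn0 def_lr.
by rewrite modnMDl modn_small // inE Bjc eqxx.
Qed.

Lemma refine_cover : \bigcup_(j <- labels e) B j \subset \bigcup_(i <- pieces e) piece e B i.
Proof.
apply/subsetP => c; rewrite !in_bigcup_seq => /hasP[j ej Bjc].
have [k k3 ck] := piece_cover ej Bjc; apply/hasP; exists (3 * j + k) => //.
by move: ej; rewrite !mem_iota; lia.
Qed.

Lemma mem_refinements (f : nat -> nat) s :
  {in s, forall j, f j < 3 /\ 0 < piece_size e (3 * j + f j)} ->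
  [seq 3 * j + f j | j <- s] \in refinements e s.
Proof.
elim: s => // j s IHs fP; apply/allpairsP.
exists (3 * j + f j, [seq 3 * j + f j | j <- s]); split=> //; last first.
  by apply: IHs => k sk; apply: fP; rewrite inE sk orbT.
have [f3 f0] := fP j (mem_head _ _).
by rewrite mem_filter f0 mem_iota /=; lia.
Qed.

(** A marked block holds exactly one counterfeit coin, which lies in exactly one of its three
    pieces; the refined state lists these pieces. *)
Lemma fits_refine X s : {subset s <= labels e} ->
  {in labels e, forall j, #|B j :&: counterfeits X| = (j \in s) :> nat} ->
  exists2 s', s' \in refinements e s &
    {in pieces e, forall i, #|piece e B i :&: counterfeits X| = (i \in s') :> nat}.
Proof.
move=> es mark.
(* For a marked block [j], [f j] is the part that contains its counterfeit coin. *)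
pose f j := find (fun k => piece e B (3 * j + k) :&: counterfeits X != set0) (iota 0 3).
have one j : j \in s -> f j < 3 /\ exists2 c, c \in piece e B (3 * j + f j) &
    B j :&: counterfeits X = [set c].
  move=> sj; have /eqP := mark j (es j sj); rewrite sj => /cards1P[c Xc].
  have : c \in B j :&: counterfeits X by rewrite Xc set11.
  case/setIP=> Bjc cX; have [k k3 ck] := piece_cover (es j sj) Bjc.
  have hasf : has (fun k => piece e B (3 * j + k) :&: counterfeits X != set0) (iota 0 3).
    apply/hasP; exists k; first by rewrite mem_iota.
    by apply/set0Pn; exists c; rewrite inE ck.
  have f3 : f j < 3 by move: hasf; rewrite has_find.
  split=> //; exists c => //; have := nth_find 0 hasf; rewrite -/(f j) nth_iota // add0n.
  case/set0Pn=> d /setIP[dj dX]; suff -> : c = d by [].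
  apply/esym/set1P; rewrite -Xc inE dX andbT.
  have := subsetP (piece_sub _) _ dj.
  by rewrite mulnC divnMDl // divn_small // addn0.
exists [seq 3 * j + f j | j <- s].
  apply: mem_refinements => j sj; have [f3 [c cj _]] := one j sj; split=> //.
  rewrite -card_piece; first by apply/card_gt0P; exists c.
  by have := es j sj; rewrite !mem_iota; lia.
(* A piece of an unmarked block has no counterfeit coin; a piece of a marked block has one exactly
   when it contains the coin [c] of that block. *)
move=> i ei; have [si|Nsi] := boolP (i %/ 3 \in s); last first.
  have -> : (i \in [seq 3 * j + f j | j <- s]) = false.
    apply/negP => /mapP[j sj def_i]; case/negP: Nsi.
    have [f3 _] := one j sj.
    by rewrite def_i mulnC divnMDl // divn_small // addn0.
  apply/eqP; rewrite cards_eq0 -subset0 /=.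
  have /eqP := mark _ (label_of ei); rewrite (negPf Nsi) cards_eq0 => /eqP <-.
  exact: setSI (piece_sub i).
have [f3 [c cj Xc]] := one _ si.
have cX : c \in counterfeits X.
  by have := set11 c; rewrite -{1}Xc => /setIP[].
have ef : 3 * (i %/ 3) + f (i %/ 3) \in pieces e.
  by have := es _ si; rewrite !mem_iota; lia.
have [ci|Nci] := boolP (c \in piece e B i).
  have def_i := disjoint_on_eq piece_disjoint ei ef ci cj.
  have -> : i \in [seq 3 * j + f j | j <- s] by apply/mapP; exists (i %/ 3).
  rewrite (_ : _ :&: _ = [set c]) ?cards1 //; apply/eqP; rewrite eqEsubset.
  by rewrite -{1}Xc setSI ?piece_sub // sub1set inE ci.
have -> : (i \in [seq 3 * j + f j | j <- s]) = false.
  apply/negP => /mapP[j sj def_i]; case/negP: Nci.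
  have [f3j _] := one j sj; rewrite {1}def_i.
  suff <- : i %/ 3 = j by [].
  by rewrite def_i mulnC divnMDl // divn_small // addn0.
apply/eqP; rewrite cards_eq0 -subset0; apply/subsetP => d /setIP[di dX].
have : d \in [set c] by rewrite -Xc inE dX (subsetP (piece_sub i)).
by move/set1P => def_d; rewrite -def_d di in Nci.
Qed.

End Refinement.

(** * Passing to the position reached after a weighing *)

Lemma sumn_map (f : nat -> nat) s : sumn [seq f i | i <- s] = \sum_(i <- s) f i.
Proof. by rewrite sumnE big_map. Qed.

(** Validity of [e'] is applied after deleting the set [R] of released coins from [W] and merging
    the kept pieces into blocks as [pre] prescribes. The check on states gives the new state, and
    the last conjunct of [check_child] recovers the coins of [R]. *)
Lemma child_solves e e' ss pre W C P :
  check_child e e' ss pre -> valid e' -> supply e <= #|W| ->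
  {in pieces e, forall i, #|C i| = piece_size e i} ->
  {in pieces e, forall i, C i \subset W} -> disjoint_on (pieces e) C ->
  (forall X, P X -> fits W (pieces e) C ss X) -> determined W P ->
  solves P (weighings e').
Proof.
case/andP=> /and5P[/eqP size_pre uk /allP kP /allP rP] /andP[/allP szP /allP smallP].
case/and3P=> supP /allP statesP /allP injP ve' supW Csz CW dC fitP detP.
have ke i : i \in flatten pre -> i \in pieces e.
  by move/kP; rewrite /= mem_iota => ->.
have re i : i \in released ss pre -> i \in pieces e.
  by move/rP; rewrite /= mem_iota => ->.
have pk c i : i \in nth [::] pre c -> i \in flatten pre.
  exact: mem_flatten_nth.
have kr i : i \in flatten pre -> i \notin released ss pre.
  by move=> ik; rewrite mem_filter ik.
have ur : uniq (released ss pre) by rewrite filter_uniq ?undup_uniq.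
pose R := \bigcup_(i <- released ss pre) C i.
have cardC s (f : nat -> {set coin}) : uniq s -> {subset s <= pieces e} ->
    (forall i, f i \subset C i) -> #|\bigcup_(i <- s) f i| = \sum_(i <- s) #|f i|.
  move=> us sub fC; apply: card_bigcup_seq => //; apply: disjoint_onP => i j x si sj fi fj.
  exact: disjoint_on_eq dC (sub i si) (sub j sj) (subsetP (fC i) _ fi)
    (subsetP (fC j) _ fj).
have keptW i : i \in flatten pre -> C i \subset W :\: R.
  move=> ik; apply/subsetP => x Cix; rewrite inE (subsetP (CW i (ke i ik))) // andbT.
  rewrite in_bigcup_seq; apply/negP => /hasP[j jr Cjx].
  have := disjoint_on_eq dC (ke i ik) (re j jr) Cix Cjx => eij.
  by case/negP: (kr i ik); rewrite eij.
apply: (ve' (W :\: R) (fun c => \bigcup_(i <- nth [::] pre c) C i)).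
- have -> : #|W :\: R| = #|W| - #|R|.
    rewrite cardsD (setIidPr _) //; apply/subsetP => x.
    by rewrite in_bigcup_seq => /hasP[i /re/CW/subsetP]; apply.
  suff : #|R| <= size (released ss pre) by lia.
  rewrite cardC // -sum1_size big_seq [leqRHS]big_seq; apply: leq_sum => i ir.
  by rewrite Csz ?re //; apply: smallP.
- move=> c _; apply/subsetP => x; rewrite in_bigcup_seq => /hasP[i /pk/keptW/subsetP]; apply.
- apply: disjoint_onP => c d x _ _; rewrite !in_bigcup_seq.
  case/hasP=> i ic Cix /hasP[j jd Cjx].
  have eij := disjoint_on_eq dC (ke i (pk _ _ ic)) (ke j (pk _ _ jd)) Cix Cjx.
  by apply: uniq_flatten_inj uk ic _; rewrite eij.
- move=> c /szP; apply: leq_trans; rewrite cardC ?uniq_flatten_nth //; last by move=> i /pk/ke.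
  rewrite sumn_map big_seq [leqRHS]big_seq; apply: leq_sum => i ic.
  by rewrite Csz // ke ?(pk _ _ ic).
- move=> X /fitP[s ss_s [mark cover]]; have /hasP[s' s'e' /allP s's] := statesP s ss_s.
  exists s' => //; split=> [c ec|].
    rewrite -(eqP (s's c ec)) big_distrl /= cardC ?uniq_flatten_nth //; first last.
    - by move=> i; apply: subsetIl.
    - by move=> i /pk/ke.
    rewrite -sum1_count [RHS]big_mkcond big_seq [RHS]big_seq; apply: eq_bigr => i ic.
    by rewrite mark ?ke ?(pk _ _ ic) //=; case: (_ \in _).
  (* A counterfeit coin of [W] lies in a piece of the state [s]; if that piece were not kept it
     would be released, and the coin would belong to [R]. *)
  apply/subsetP => x /setIP[/setDP[xW NRx] xX].
  have := subsetP cover x; rewrite in_setI xW xX => /(_ isT); rewrite !in_bigcup_seq.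
  case/hasP=> i ie Cix.
  have si : i \in s.
    have := mark i ie; case: (i \in s) => // /eqP; rewrite cards_eq0 => /eqP/setP/(_ x).
    by rewrite in_setI in_set0 Cix xX.
  have [/flattenP[l pre_l il]|Nk] := boolP (i \in flatten pre); last first.
    case/negP: NRx; rewrite in_bigcup_seq; apply/hasP; exists i => //.
    by rewrite mem_filter Nk mem_undup; apply/flattenP; exists s.
  apply/hasP; exists (index l pre); first by rewrite mem_iota -size_pre index_mem.
  by rewrite in_bigcup_seq nth_index //; apply/hasP; exists i.
(* Agreement outside [R] makes the two states agree on the kept pieces, hence on the released ones
   by [injP]. A released piece has at most one coin, so its count determines its counterfeit
   coins. *)
move=> X Y PX PY eqXY; apply: detP => //.
have [s ss_s [markX coverX]] := fitP X PX; have [u ss_u [markY coverY]] := fitP Y PY.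
have eqk : {in flatten pre, forall i, C i :&: counterfeits X = C i :&: counterfeits Y}.
  move=> i ik; have /setIidPl <- := keptW i ik.
  by rewrite -!setIA eqXY.
have /allP/(_ u ss_u)/implyP := injP s ss_s.
have -> : all (fun i => (i \in s) == (i \in u)) (flatten pre).
  apply/allP => i ik; have := eqk i ik => /(congr1 (fun A : {set coin} => #|A|)).
  by rewrite markX ?markY ?ke //; do 2!case: (_ \in _).
move=> /(_ isT)/allP eqr.
have eqrC : {in released ss pre, forall i, C i :&: counterfeits X = C i :&: counterfeits Y}.
  move=> i ir; have ie := re i ir; have le1 := smallP i ir.
  have := markX i ie; rewrite (eqP (eqr i ir)) -(markY i ie) => eqc.
  have le1C : #|C i| <= 1 by rewrite Csz.
  have : forall A B : {set coin}, A \subset C i -> B \subset C i -> #|A| = #|B| -> A = B.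
    move=> A B AC BC eqAB; have [/eqP A0|[a Aa]] := set_0Vmem A.
      by move: eqAB; rewrite (eqP A0) cards0 => /esym/eqP; rewrite cards_eq0 => /eqP->.
    have eqC (D : {set coin}) : D \subset C i -> 0 < #|D| -> D = C i.
      by move=> DC D0; apply/eqP; rewrite eqEcard DC (leq_trans le1C).
    have A0 : 0 < #|A| by apply/card_gt0P; exists a.
    by rewrite (eqC A) // (eqC B) // -eqAB.
  by apply=> //; apply: subsetIl.
apply/setP => x; have [Rx|NRx] := boolP (x \in R); last first.
  by have /setP/(_ x) := eqXY; rewrite !in_setI in_setD NRx.
move: Rx; rewrite in_bigcup_seq => /hasP[i ir Cix].
by have /setP/(_ x) := eqrC i ir; rewrite !in_setI Cix /= => ->.
Qed.

Lemma sgz_sub (a b : nat) :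
  [/\ sgz (a%:Z - b%:Z)%R = 1%R -> b < a, sgz (a%:Z - b%:Z)%R = 0%R -> b = a &
      sgz (a%:Z - b%:Z)%R = (-1)%R -> a < b].
Proof. by split; case: sgzP => //; lia. Qed.

(** Padding adds genuine coins only: a counterfeit coin of [C j] lies in some [B i], and
    disjointness of the [C] blocks forces [i = j]. *)
Lemma fits_pad W e B C X :
  {in labels e, forall j, B j \subset C j} -> disjoint_on (labels e) C ->
  {in labels e, forall j, C j \subset W} ->
  fits W (labels e) B (states e) X -> fits W (labels e) C (states e) X.
Proof.
move=> BC dC CW [s se [mark cover]]; exists s => //; split=> [j ej|].
  rewrite -(mark j ej); congr #|pred_of_set _|; apply/eqP; rewrite eqEsubset.
  rewrite andbC setSI ?BC //=; apply/subsetP => x /setIP[Cx xX]; rewrite in_setI xX andbT.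
  have : x \in W :&: counterfeits X by rewrite in_setI xX (subsetP (CW j ej)).
  move/(subsetP cover); rewrite in_bigcup_seq => /hasP[i ei Bix].
  by rewrite (disjoint_on_eq dC ej ei Cx (subsetP (BC i ei) _ Bix)).
apply: subset_trans cover _; apply/subsetP => x; rewrite !in_bigcup_seq.
by case/hasP=> i ei /(subsetP (BC i ei)) Cix; apply/hasP; exists i.
Qed.

(** The blocks are padded to their exact sizes, the pieces are weighed with genuine ballast, and
    each outcome is passed to [child_solves]. *)
Lemma check_entry_valid db k :
  check_entry db k -> (forall i, i < k -> valid (nth stop db i)) ->
  valid (nth stop db k).
Proof.
rewrite /check_entry; set e := nth stop db k => chk IHdb W B P supW BW dB Bsz fitB detP.
(* At a leaf there are no blocks, so [W] has no counterfeit coin and [determined] leaves a single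
   configuration. *)
case def_t: (weighings e) chk => [|t].
  move/eqP=> sz0; exists (Stop n); split=> // X Y PX PY _; apply: detP => //.
  have W0 Z : P Z -> W :&: counterfeits Z = set0.
    by move/fitB => [s _ []]; rewrite /labels sz0 /= big_nil subset0 => _ /eqP.
  by rewrite !W0.
case/andP=> /and4P[/allP pansP /allP stP supL supR] /and3P[chkL chk0 chkR].
(* With full blocks the pieces have exactly the tabulated sizes, as the balancing of the pans
   requires. *)
have [|C [BC CW dC Csz]] := pad_family (iota_uniq _ _) _ BW dB Bsz.
  apply: leq_trans supW; apply: leq_trans supL; apply: leq_trans (leq_addr _ _).
  rewrite -sumn_map; apply: eq_leq; congr sumn.
  by rewrite -[RHS](mkseq_nth 0).
have fitC X : P X -> fits W (labels e) C (states e) X.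
  by move/fitB; apply: fits_pad.
pose U := \bigcup_(j <- labels e) C j; pose G := W :\: U.
have cardG : sumn (sizes e) + #|G| = #|W|.
  have UW : U \subset W.
    by apply/subsetP => x; rewrite in_bigcup_seq => /hasP[j /CW/subsetP]; apply.
  rewrite cardsD (setIidPr UW); have := subset_leq_card UW.
  suff -> : sumn (sizes e) = #|U| by lia.
  rewrite card_bigcup_seq ?iota_uniq // big_seq (eq_bigr (fun j => nth 0 (sizes e) j)).
    by rewrite -big_seq -sumn_map -[in LHS](mkseq_nth 0 (sizes e)).
  by move=> j ej; apply: Csz.
(* [cut G k 0 0] picks [k] coins of [G], the coins of [W] outside all blocks. *)
pose pan i k := (\bigcup_(j <- labels e) piece e C (3 * j + i)) :|: cut G k 0 0.
have piece3 i j : i < 3 -> j \in labels e -> 3 * j + i \in pieces e.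
  by rewrite !mem_iota; lia.
have dpan i (f : nat -> {set coin}) : i < 3 -> (forall j, f j \subset piece e C (3 * j + i)) ->
    #|\bigcup_(j <- labels e) f j| = \sum_(j <- labels e) #|f j|.
  move=> i3 fC; apply: card_bigcup_seq (iota_uniq _ _) _.
  apply: disjoint_onP => j1 j2 x e1 e2 f1 f2.
  have := disjoint_on_eq (piece_disjoint dC) (piece3 i j1 i3 e1) (piece3 i j2 i3 e2).
  move=> /(_ x (subsetP (fC j1) _ f1) (subsetP (fC j2) _ f2)); lia.
have pieceU i j : i < 3 -> j \in labels e -> piece e C (3 * j + i) \subset U.
  move=> i3 ej; apply/subsetP => x /(subsetP (piece_sub _ _ _)) xC.
  rewrite in_bigcup_seq; apply/hasP; exists j => //.
  by move: xC; rewrite mulnC divnMDl // divn_small // addn0.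
have card_pan i d : i < 3 -> d <= #|G| -> #|pan i d| = pan_size e i + d.
  move=> i3 dG; rewrite cardsU (dpan i) // card_cut0 ?addn0 // [_ :&: _](_ : _ = set0).
    rewrite cards0 subn0 /pan_size sumn_map; congr (_ + _).
    by rewrite big_seq [RHS]big_seq; apply: eq_bigr => j ej; rewrite card_piece ?piece3.
  apply/setP => x; rewrite in_setI in_bigcup_seq in_set0; apply/negP => /andP[/hasP[j ej xj]].
  by rewrite !inE (subsetP (pieceU i j i3 ej)).
pose l := pan_size e 0; pose r := pan_size e 2.
(* By truncation, at most one pan receives ballast. *)
have eq_pans : #|pan 0 (r - l)| = #|pan 2 (l - r)|.
  by rewrite !card_pan //; move: supL supR; rewrite -/l -/r; lia.
pose w := Weighing eq_pans.
have refine X : P X -> exists s, [/\ s \in flatten [seq refinements e s | s <- states e],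
    {in pieces e, forall i, #|piece e C i :&: counterfeits X| = (i \in s) :> nat},
    W :&: counterfeits X \subset \bigcup_(i <- pieces e) piece e C i &
    outcome w X = sgz ((pan_load e 0 s)%:Z - (pan_load e 2 s)%:Z)%R].
  move=> /fitC[s se [mark cover]].
  have sub : {subset s <= labels e}.
    by move=> j js; have /allP/(_ j js) := stP s se; rewrite /= mem_iota.
  have [s' s's mark'] := fits_refine pansP dC Csz sub mark.
  (* The ballast is genuine, so only the marked pieces contribute to the load. *)
  have load i d : i < 3 -> #|pan i d :&: counterfeits X| = pan_load e i s'.
    move=> i3; rewrite setIUl [X in _ :|: X](_ : _ = set0) ?setU0.
      rewrite big_distrl /= (dpan i) //; last by move=> j; apply: subsetIl.
      rewrite /pan_load -sum1_count [RHS]big_mkcond big_seq [RHS]big_seq.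
      by apply: eq_bigr => j ej; rewrite mark' ?piece3 //; case: (_ \in _).
    apply/setP => x; rewrite in_set0; apply/negP => /setIP[xG xX]; move: xG; rewrite !inE -andbA.
    case/and3P=> NUx Wx _; case/negP: NUx; apply: (subsetP cover).
    by rewrite in_setI Wx xX.
  exists s'; split=> //.
  - by apply/flattenP; exists (refinements e s) => //; apply: map_f.
  - exact: subset_trans cover (refine_cover _ _).
  by rewrite /outcome /= !load.
apply: (solves_weigh (w := w)) => o.
have branch p cmp (Q : config -> Prop) : [&& p.1 < k, weighings (nth stop db p.1) < t.+1 &
    check_child e (nth stop db p.1) (refined_states e cmp) p.2] ->
    (forall X s, P X -> Q X -> outcome w X = sgz ((pan_load e 0 s)%:Z - (pan_load e 2 s)%:Z)%R ->
       cmp (pan_load e 2 s) (pan_load e 0 s)) ->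
    solves (fun X => P X /\ Q X) t.
  case/and3P=> pk tk chk Qcmp; apply: solves_leq (_ : weighings (nth stop db p.1) <= t) _ => //.
  apply: (child_solves chk (IHdb _ pk) supW (C := piece e C)).
  - exact: card_piece.
  - exact: pieceW.
  - exact: piece_disjoint.
  - move=> X [PX QX]; have [s [ss mark cover out]] := refine X PX.
    exists s => //; rewrite mem_filter ss andbT.
    exact: Qcmp out.
  by move=> X Y [PX _] [PY _]; apply: detP.
rewrite !inE => /or3P[] /eqP->.
- apply: branch chkL _ => X s PX -> /esym.
  by case: (sgz_sub (pan_load e 0 s) (pan_load e 2 s)).
- apply: branch chk0 _ => X s PX -> /esym.
  by case: (sgz_sub (pan_load e 0 s) (pan_load e 2 s)) => _ + _ => /[apply]->.
- apply: branch chkR _ => X s PX -> /esym.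
  by case: (sgz_sub (pan_load e 0 s) (pan_load e 2 s)).
Qed.

(** Strong induction on the index, since entries refer only to earlier ones. *)
Lemma check_table_valid db k : check_table db -> k < size db -> valid (nth stop db k).
Proof.
move=> /allP chk; have [N] := ubnP k; elim: N k => // N IHN k ltkN ltk.
apply: check_entry_valid; first by apply: chk; rewrite mem_iota.
by move=> i ltik; apply: IHN; lia.
Qed.

End Soundness.

(** * The table of positions *)

Definition node t N sz ss w l pl b pb r pr :=
  Entry t N sz ss w (l, pl) (b, pb) (r, pr).

(** A [pans] list may be shorter than [sizes]: by the default [(0, 0)] the remaining blocks stay off
    the balance. A branch [0 [::]] is an outcome that is impossible or that determines all the
    counterfeit coins. *)
Definition table : seq entry := [::
  node 0 0 [::] [::[::]] [::] 0 [::] 0 [::] 0 [::];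
  node 1 4 [::1;1;1;1] [::[::0;2];[::0;3];[::1;2]] [::(0,0);(1,0);(0,0);(0,1)]
    0 [::] 0 [::] 0 [::];
  node 1 2 [::2] [::[::0]] [::(1,1)] 0 [::] 0 [::] 0 [::];
  node 2 6 [::2;2;2] [::[::0;1;2]] [::(0,1);(1,0);(1,1)] 1 [::[::1];[::2];
    [::3];[::4]] 2 [::[::6;8]] 1 [::[::2];[::1];[::4];[::3]];
  node 3 8 [::2;2;2;2] [::[::0;1;2;3]] [::(1,1)] 3 [::[::4];[::7];[::10]] 0
    [::] 3 [::[::4];[::7];[::10]];
  node 4 10 [::2;2;2;2;2] [::[::0;1;2;3;4]] [::(1,1)] 4 [::[::4];[::7];[::10];
    [::13]] 0 [::] 4 [::[::4];[::7];[::10];[::13]];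
  node 1 3 [::3] [::[::0]] [::(1,1)] 0 [::] 0 [::] 0 [::];
  node 2 6 [::3;3] [::[::0;1]] [::(1,1)] 6 [::[::4]] 6 [::[::4]] 6 [::[::4]];
  node 2 10 [::1;2;3;2] [::[::0;3];[::1;2]] [::(1,0);(1,1);(0,3)] 2 [::[::10]]
    6 [::[::8]] 6 [::[::8]];
  node 2 6 [::2;4] [::[::0;1]] [::(1,1);(1,1)] 6 [::[::3;4]] 2 [::[::3;5]] 6
    [::[::4;5]];
  node 3 10 [::5;5] [::[::0;1]] [::(1,2);(3,2)] 7 [::[::0;1];[::3]] 8
    [::[::0];[::2];[::3];[::5]] 9 [::[::5];[::1;2]];
  node 3 8 [::4;4] [::[::0;1]] [::(2,2)] 9 [::[::0];[::4]] 0 [::] 9 [::[::2];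
    [::4]];
  node 3 10 [::2;2;2;2;2] [::[::0;1;3];[::0;1;4];[::0;2;3]] [::(0,0);(0,0);
    (2,0);(0,0);(0,2)] 3 [::[::1];[::6];[::10]] 3 [::[::1];[::4];[::10]] 3
    [::[::1];[::4];[::14]];
  node 3 12 [::2;2;2;2;2;2] [::[::0;3;5];[::1;2;4]] [::(0,0);(0,0);(0,0);
    (0,0);(2,0);(0,2)] 3 [::[::4];[::7];[::12]] 0 [::] 3 [::[::1];[::10];
    [::17]];
  node 4 12 [::4;4;4] [::[::0;1;2]] [::(2,2);(2,0);(0,2)] 12 [::[::0];[::3];
    [::4];[::7];[::8]] 13 [::[::0];[::2];[::3];[::4];[::7];[::8]] 12 [::[::2];
    [::4];[::3];[::8];[::7]];
  node 3 10 [::2;2;6] [::[::0;1;2]] [::(0,0);(0,0);(2,2)] 3 [::[::1];[::4];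
    [::6]] 3 [::[::1];[::4];[::7]] 3 [::[::1];[::4];[::8]];
  node 4 14 [::2;6;6] [::[::0;1;2]] [::(0,0);(2,2)] 15 [::[::1];[::3];[::7]]
    15 [::[::1];[::4];[::7]] 15 [::[::1];[::5];[::7]];
  node 5 18 [::6;6;6] [::[::0;1;2]] [::(2,2)] 16 [::[::0];[::4];[::7]] 16
    [::[::1];[::4];[::7]] 16 [::[::2];[::4];[::7]];
  node 6 20 [::2;6;6;6] [::[::0;1;2;3]] [::(1,1)] 17 [::[::4];[::7];[::10]] 0
    [::] 17 [::[::4];[::7];[::10]];
  node 7 24 [::6;6;6;6] [::[::0;1;2;3]] [::(2,2)] 18 [::[::0];[::4];[::7];
    [::10]] 18 [::[::1];[::4];[::7];[::10]] 18 [::[::2];[::4];[::7];[::10]];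
  node 4 13 [::3;5;5] [::[::0;1;2]] [::(1,1)] 10 [::[::4];[::7]] 10 [::[::4];
    [::7]] 10 [::[::4];[::7]];
  node 5 16 [::3;3;5;5] [::[::0;1;2;3]] [::(1,1)] 20 [::[::4];[::7];[::10]] 20
    [::[::4];[::7];[::10]] 20 [::[::4];[::7];[::10]];
  node 5 20 [::1;2;3;2;5;5] [::[::0;3;4;5];[::1;2;4;5]] [::(1,0);(1,1);(0,3)]
    16 [::[::10];[::13];[::16]] 20 [::[::8];[::13];[::16]] 20 [::[::8];[::13];
    [::16]];
  node 5 17 [::4;2;5;5] [::[::0;1;2;3]] [::(1,3);(1,0)] 16 [::[::3;4];[::7];
    [::10]] 20 [::[::2];[::7];[::10]] 20 [::[::2];[::7];[::10]];
  node 6 20 [::5;5;5;5] [::[::0;1;2;3]] [::(1,2);(3,2)] 21 [::[::0;1];[::3];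
    [::7];[::10]] 22 [::[::0];[::2];[::3];[::5];[::7];[::10]] 23 [::[::1;2];
    [::5];[::7];[::10]];
  node 5 14 [::2;4;4;4] [::[::0;1;2;3]] [::(1,1)] 14 [::[::4];[::7];[::10]] 0
    [::] 14 [::[::4];[::7];[::10]];
  node 6 16 [::4;4;4;4] [::[::0;1;2;3]] [::(2,2)] 25 [::[::0];[::4];[::7];
    [::10]] 0 [::] 25 [::[::2];[::4];[::7];[::10]];
  node 8 26 [::2;6;6;6;6] [::[::0;1;2;3;4]] [::(1,1)] 19 [::[::4];[::7];
    [::10];[::13]] 0 [::] 19 [::[::4];[::7];[::10];[::13]];
  node 9 30 [::6;6;6;6;6] [::[::0;1;2;3;4]] [::(2,2)] 27 [::[::0];[::4];[::7];
    [::10];[::13]] 27 [::[::1];[::4];[::7];[::10];[::13]] 27 [::[::2];[::4];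
    [::7];[::10];[::13]];
  node 7 21 [::3;3;5;5;5] [::[::0;1;2;3;4]] [::(1,1)] 24 [::[::4];[::7];
    [::10];[::13]] 24 [::[::4];[::7];[::10];[::13]] 24 [::[::4];[::7];[::10];
    [::13]];
  node 7 25 [::1;2;3;2;5;5;5] [::[::0;3;4;5;6];[::1;2;4;5;6]] [::(1,0);(1,1);
    (0,3)] 18 [::[::10];[::13];[::16];[::19]] 24 [::[::8];[::13];[::16];
    [::19]] 24 [::[::8];[::13];[::16];[::19]];
  node 7 22 [::4;2;5;5;5] [::[::0;1;2;3;4]] [::(1,3);(1,0)] 18 [::[::3;4];
    [::7];[::10];[::13]] 24 [::[::2];[::7];[::10];[::13]] 24 [::[::2];[::7];
    [::10];[::13]];
  node 8 25 [::5;5;5;5;5] [::[::0;1;2;3;4]] [::(1,2);(3,2)] 29 [::[::0;1];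
    [::3];[::7];[::10];[::13]] 30 [::[::0];[::2];[::3];[::5];[::7];[::10];
    [::13]] 31 [::[::1;2];[::5];[::7];[::10];[::13]];
  node 3 10 [::2;2;2;2;2] [::[::0;2;4];[::1;3;4]] [::(0,0);(0,0);(2,0);(0,2)]
    3 [::[::1];[::6];[::13]] 0 [::] 3 [::[::4];[::11];[::13]];
  node 4 12 [::2;4;4;2] [::[::0;1;2;3]] [::(1,1);(2,0);(0,2)] 12 [::[::10];
    [::3];[::4];[::7];[::8]] 33 [::[::3];[::4];[::7];[::8];[::10]] 12
    [::[::10];[::4];[::3];[::8];[::7]];
  node 5 16 [::2;2;2;2;4;4] [::[::0;2;4;5];[::0;3;4;5];[::1;2;4;5]] [::(0,0);
    (2,0);(0,0);(0,2)] 34 [::[::3];[::13];[::16];[::7]] 34 [::[::1];[::13];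
    [::16];[::7]] 34 [::[::1];[::13];[::16];[::11]];
  node 5 16 [::2;2;2;2;4;4] [::[::0;2;4;5];[::1;3;4;5]] [::(0,0);(0,0);(2,0);
    (0,2)] 34 [::[::1];[::13];[::16];[::6]] 0 [::] 34 [::[::4];[::13];[::16];
    [::11]];
  node 6 18 [::2;4;4;4;4] [::[::0;1;2;3;4]] [::(1,1);(2,0);(0,2)] 35 [::[::3];
    [::4];[::7];[::8];[::10];[::13]] 36 [::[::3];[::4];[::7];[::8];[::10];
    [::13]] 35 [::[::4];[::3];[::8];[::7];[::10];[::13]];
  node 7 20 [::4;4;4;4;4] [::[::0;1;2;3;4]] [::(2,2)] 37 [::[::0];[::4];[::7];
    [::10];[::13]] 0 [::] 37 [::[::2];[::4];[::7];[::10];[::13]];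
  node 2 9 [::9] [::[::0]] [::(3,3)] 6 [::[::0]] 6 [::[::1]] 6 [::[::2]];
  node 3 16 [::1;2;7;6] [::[::0;2];[::0;3];[::1;2]] [::(0,0);(1,1);(0,0);
    (2,2)] 39 [::[::7;9]] 39 [::[::7;10]] 39 [::[::7;11]];
  node 2 11 [::1;2;1;7] [::[::0;3];[::1;2]] [::(0,0);(0,2);(0,0);(3,1)] 6
    [::[::9]] 6 [::[::10]] 6 [::[::1;5]];
  node 3 24 [::1;2;1;7;6;7] [::[::0;5];[::1;4];[::2;3]] [::(1,0);(0,0);(0,1);
    (0,0);(1,1)] 41 [::[::0];[::4];[::12];[::16]] 9 [::[::4];[::13]] 41
    [::[::8];[::4];[::14];[::10]];
  node 4 24 [::4;20] [::[::0;1]] [::(1,1);(7,7)] 40 [::[::0];[::1];[::3];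
    [::4]] 42 [::[::0];[::1];[::2];[::3];[::4];[::5]] 40 [::[::2];[::1];[::5];
    [::4]];
  node 5 27 [::3;4;20] [::[::0;1;2]] [::(1,1)] 43 [::[::4];[::7]] 43 [::[::4];
    [::7]] 43 [::[::4];[::7]];
  node 6 33 [::4;9;20] [::[::0;1;2]] [::(0,0);(3,3)] 44 [::[::3];[::1];[::7]]
    44 [::[::4];[::1];[::7]] 44 [::[::5];[::1];[::7]];
  node 7 40 [::1;2;7;6;4;20] [::[::0;2;4;5];[::0;3;4;5];[::1;2;4;5]] [::(0,0);
    (1,1);(0,0);(2,2)] 45 [::[::13];[::7;9];[::16]] 45 [::[::13];[::7;10];
    [::16]] 45 [::[::13];[::7;11];[::16]];
  node 6 35 [::1;2;1;7;4;20] [::[::0;3;4;5];[::1;2;4;5]] [::(0,0);(0,2);(0,0);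
    (3,1)] 44 [::[::9];[::13];[::16]] 44 [::[::10];[::13];[::16]] 44 [::[::1;
    5];[::13];[::16]];
  node 6 31 [::2;4;4;20] [::[::0;1;2;3]] [::(1,1);(1,2)] 44 [::[::3;4];[::7];
    [::10]] 44 [::[::3;5];[::7];[::10]] 44 [::[::4;5];[::7];[::10]];
  node 7 48 [::1;2;1;7;6;7;4;20] [::[::0;5;6;7];[::1;4;6;7];[::2;3;6;7]]
    [::(1,0);(0,0);(0,1);(0,0);(1,1)] 47 [::[::0];[::4];[::12];[::16];[::19];
    [::22]] 48 [::[::4];[::13];[::19];[::22]] 47 [::[::8];[::4];[::14];[::10];
    [::19];[::22]];
  node 8 48 [::4;20;4;20] [::[::0;1;2;3]] [::(1,1);(7,7)] 46 [::[::0];[::1];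
    [::3];[::4];[::7];[::10]] 49 [::[::0];[::1];[::2];[::3];[::4];[::5];[::7];
    [::10]] 46 [::[::2];[::1];[::5];[::4];[::7];[::10]];
  node 9 56 [::4;12;20;20] [::[::0;1;2;3]] [::(0,0);(4,4)] 50 [::[::1];[::7];
    [::3];[::10]] 50 [::[::1];[::7];[::4];[::10]] 50 [::[::1];[::7];[::5];
    [::10]];
  node 10 64 [::12;12;20;20] [::[::0;1;2;3]] [::(4,4)] 51 [::[::0];[::4];
    [::7];[::10]] 51 [::[::1];[::4];[::7];[::10]] 51 [::[::2];[::4];[::7];
    [::10]];
  node 10 80 [::4;8;12;8;20;20] [::[::0;3;4;5];[::1;2;4;5]] [::(4,0);(4,4);
    (0,12)] 51 [::[::0];[::10];[::13];[::16]] 51 [::[::3];[::8];[::13];[::16]]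
    51 [::[::5];[::8];[::13];[::16]];
  node 10 68 [::16;8;20;20] [::[::0;1;2;3]] [::(4,12);(4,0)] 51 [::[::0];[::3;
    4];[::7];[::10]] 51 [::[::3];[::2];[::7];[::10]] 51 [::[::4];[::2];[::7];
    [::10]];
  node 11 80 [::20;20;20;20] [::[::0;1;2;3]] [::(4,8);(12,8)] 52 [::[::0;1];
    [::3];[::7];[::10]] 53 [::[::0];[::2];[::3];[::5];[::7];[::10]] 54
    [::[::1;2];[::5];[::7];[::10]];
  node 5 32 [::12;20] [::[::0;1]] [::(4,4)] 43 [::[::0];[::4]] 43 [::[::1];
    [::4]] 43 [::[::2];[::4]];
  node 6 35 [::3;12;20] [::[::0;1;2]] [::(1,1)] 56 [::[::4];[::7]] 56
    [::[::4];[::7]] 56 [::[::4];[::7]];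
  node 6 54 [::1;2;12;8;20] [::[::0;3;4];[::1;2;4]] [::(1,0);(1,1);(0,12)] 56
    [::[::10];[::13]] 56 [::[::8];[::13]] 56 [::[::8];[::13]];
  node 6 34 [::4;8;20] [::[::0;1;2]] [::(1,3);(4,0)] 56 [::[::3;4];[::7]] 44
    [::[::2];[::3];[::7]] 44 [::[::2];[::4];[::7]];
  node 7 54 [::5;20;20] [::[::0;1;2]] [::(1,2);(12,8)] 57 [::[::0;1];[::3];
    [::7]] 58 [::[::0];[::2];[::3];[::5];[::7]] 59 [::[::1;2];[::5];[::7]];
  node 8 55 [::3;5;20;20] [::[::0;1;2;3]] [::(1,1)] 60 [::[::4];[::7];[::10]]
    60 [::[::4];[::7];[::10]] 60 [::[::4];[::7];[::10]];
  node 8 55 [::5;5;1;2;20;20] [::[::0;3;4;5];[::1;2;4;5]] [::(0,0);(0,0);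
    (1,0);(0,1)] 60 [::[::4];[::13];[::16]] 60 [::[::1];[::13];[::16]] 60
    [::[::1];[::13];[::16]];
  node 9 59 [::5;5;7;2;20;20] [::[::0;3;4;5];[::1;2;4;5]] [::(0,0);(0,0);
    (3,3)] 61 [::[::6];[::4];[::13];[::16]] 62 [::[::1];[::4];[::7];[::10];
    [::13];[::16]] 61 [::[::8];[::4];[::13];[::16]];
  node 9 55 [::5;9;20;20] [::[::0;1;2;3]] [::(0,0);(3,3)] 61 [::[::3];[::1];
    [::7];[::10]] 61 [::[::4];[::1];[::7];[::10]] 61 [::[::5];[::1];[::7];
    [::10]];
  node 10 68 [::5;10;7;6;20;20] [::[::0;2;4;5];[::0;3;4;5];[::1;2;4;5]]
    [::(0,0);(5,5);(0,0);(2,2)] 63 [::[::1];[::3];[::7];[::9];[::13];[::16]]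
    64 [::[::1];[::7;10];[::13];[::16]] 63 [::[::1];[::5];[::7];[::11];[::13];
    [::16]];
  node 8 55 [::15;20;20] [::[::0;1;2]] [::(5,5)] 60 [::[::0];[::4];[::7]] 60
    [::[::1];[::4];[::7]] 60 [::[::2];[::4];[::7]];
  node 9 71 [::5;10;1;7;20;20] [::[::0;3;4;5];[::1;2;4;5]] [::(0,0);(0,10);
    (0,0);(3,1)] 61 [::[::9];[::1];[::13];[::16]] 61 [::[::10];[::1];[::13];
    [::16]] 66 [::[::1;5];[::13];[::16]];
  node 10 76 [::5;9;5;7;5;7;19;19] [::[::0;5;6;7];[::1;4;6;7];[::2;3;6;7]]
    [::(5,0);(0,0);(0,5);(0,0);(1,1)] 67 [::[::0];[::4];[::12];[::16];[::19];
    [::22]] 51 [::[::13];[::4];[::19];[::22]] 67 [::[::8];[::4];[::14];[::10];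
    [::19];[::22]];
  node 11 76 [::19;19;19;19] [::[::0;1;2;3]] [::(5,5);(7,7)] 65 [::[::0];
    [::1];[::3];[::4];[::7];[::10]] 68 [::[::0];[::1];[::2];[::3];[::4];[::5];
    [::7];[::10]] 65 [::[::2];[::1];[::5];[::4];[::7];[::10]];
  node 3 21 [::1;1;3;6;2;1] [::[::0;2;4];[::0;2;5];[::0;3;4];[::1;2;4]]
    [::(0,1);(1,0);(0,0);(6,0);(1,1);(1,0)] 39 [::[::7;9]] 7 [::[::7];[::12;
    14;15]] 39 [::[::7;9]];
  node 4 21 [::1;1;3;6;6;3] [::[::0;2;4];[::0;2;5];[::0;3;4];[::1;2;4]]
    [::(0,0);(0,0);(0,0);(0,0);(2,2);(1,1)] 70 [::[::1];[::4];[::7];[::10];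
    [::12];[::15]] 70 [::[::1];[::4];[::7];[::10];[::13];[::16]] 70 [::[::1];
    [::4];[::7];[::10];[::14];[::17]];
  node 3 15 [::3;8;3;1] [::[::0;3];[::1;2]] [::(1,1);(0,0);(1,1)] 39 [::[::0;
    4]] 39 [::[::1;4]] 39 [::[::2;4]];
  node 3 12 [::3;9] [::[::0;1]] [::(0,0);(3,3)] 7 [::[::1];[::3]] 7 [::[::1];
    [::4]] 7 [::[::1];[::5]];
  node 4 22 [::3;6;2;6;3;2] [::[::0;4];[::0;5];[::1;3];[::1;4];[::2;3]]
    [::(0,0);(0,0);(0,0);(3,3);(0,0);(1,1)] 72 [::[::1];[::4;7];[::9];[::15]]
    73 [::[::13];[::1;4]] 72 [::[::1];[::4;7];[::11];[::17]];
  node 3 21 [::1;1;3;8;1;1] [::[::0;3;4];[::0;3;5];[::1;2;4];[::1;3;4]]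
    [::(1,0);(0,0);(1,1);(0,8);(0,0);(1,0)] 39 [::[::6;11]] 39 [::[::7;11]] 39
    [::[::8;11]];
  node 3 20 [::9;2;8;1] [::[::0;3];[::1;2];[::1;3]] [::(8,1);(1,0);(0,8)] 39
    [::[::0;3]] 39 [::[::8;10]] 39 [::[::8;10]];
  node 3 13 [::6;2;1;3] [::[::0;3];[::1;2];[::1;3]] [::(3,0);(0,2)] 7
    [::[::0];[::10]] 7 [::[::1];[::10]] 9 [::[::5];[::7;10]];
  node 4 26 [::1;1;3;6;2;6;3;2] [::[::0;3;7];[::0;4;6];[::0;4;7];[::1;2;7];
    [::1;3;6];[::1;3;7];[::1;4;5];[::1;4;6];[::1;4;7]] [::(1,0);(0,0);(0,0);
    (0,0);(0,0);(0,1);(0,3);(1,0)] 75 [::[::0];[::4];[::7];[::10;13];[::21];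
    [::22]] 76 [::[::7;10];[::13];[::16;20];[::22]] 77 [::[::10];[::13];
    [::17];[::20]];
  node 5 28 [::2;11;11] [::[::0;1;2]] [::(0,1);(3,2);(6,2)] 71 [::[::1];[::2];
    [::3];[::4];[::6];[::7]] 74 [::[::3];[::4];[::5];[::6];[::7];[::8]] 78
    [::[::1];[::2];[::3];[::4];[::5];[::6];[::7];[::8]];
  node 6 29 [::2;3;11;11] [::[::0;1;2;3]] [::(0,0);(1,1)] 79 [::[::1];[::7];
    [::10]] 79 [::[::1];[::7];[::10]] 79 [::[::1];[::7];[::10]];
  node 7 32 [::2;8;11;11] [::[::0;1;2;3]] [::(0,0);(3,3)] 80 [::[::1];[::3];
    [::7];[::10]] 80 [::[::1];[::4];[::7];[::10]] 80 [::[::1];[::5];[::7];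
    [::10]];
  node 6 29 [::2;2;1;2;11;11] [::[::0;3;4;5];[::1;2;4;5]] [::(0,0);(0,0);
    (1,0);(0,1)] 79 [::[::4];[::13];[::16]] 79 [::[::1];[::13];[::16]] 79
    [::[::1];[::13];[::16]];
  node 7 35 [::2;2;4;5;11;11] [::[::0;3;4;5];[::1;2;4;5]] [::(0,0);(0,0);
    (3,1);(0,2)] 80 [::[::4];[::6];[::13];[::16]] 80 [::[::1];[::10];[::13];
    [::16]] 82 [::[::1];[::4];[::8];[::11];[::13];[::16]];
  node 7 33 [::2;9;11;11] [::[::0;1;2;3]] [::(0,0);(3,3)] 80 [::[::1];[::3];
    [::7];[::10]] 80 [::[::1];[::4];[::7];[::10]] 80 [::[::1];[::5];[::7];
    [::10]];
  node 8 40 [::4;13;11;11] [::[::0;1;2;3]] [::(2,2);(4,5)] 81 [::[::0];[::3;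
    4];[::7];[::10]] 83 [::[::0];[::2];[::3];[::5];[::7];[::10]] 84 [::[::2];
    [::4;5];[::7];[::10]];
  node 9 44 [::11;11;11;11] [::[::0;1;2;3]] [::(4,4)] 85 [::[::0];[::10];
    [::4];[::7]] 85 [::[::1];[::10];[::4];[::7]] 85 [::[::2];[::10];[::4];
    [::7]];
  node 9 40 [::10;10;10;10] [::[::0;1;2;3]] [::(3,3)] 85 [::[::0];[::10];
    [::4];[::7]] 85 [::[::1];[::10];[::4];[::7]] 85 [::[::2];[::10];[::4];
    [::7]];
  node 6 28 [::6;11;11] [::[::0;1;2]] [::(2,2)] 79 [::[::0];[::4];[::7]] 79
    [::[::1];[::4];[::7]] 79 [::[::2];[::4];[::7]];
  node 7 39 [::11;11;17] [::[::0;1;2]] [::(0,0);(0,0);(6,6)] 88 [::[::6];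
    [::1];[::4]] 88 [::[::7];[::1];[::4]] 88 [::[::8];[::1];[::4]];
  node 8 42 [::3;11;11;17] [::[::0;1;2;3]] [::(1,1)] 89 [::[::4];[::7];[::10]]
    89 [::[::4];[::7];[::10]] 89 [::[::4];[::7];[::10]];
  node 9 58 [::6;5;3;11;11;17] [::[::0;2;4;5];[::0;3;4;5];[::1;2;4;5]]
    [::(0,3);(0,0);(0,3);(11,0)] 90 [::[::1];[::9];[::13];[::16]] 90 [::[::2];
    [::9];[::13];[::16]] 90 [::[::8];[::1;2;4];[::13];[::16]];
  node 8 45 [::6;5;3;3;11;17] [::[::0;2;4;5];[::1;3;4;5]] [::(0,0);(0,0);
    (1,1);(1,1)] 89 [::[::1;4];[::13];[::16]] 89 [::[::1;4];[::13];[::16]] 89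
    [::[::1;4];[::13];[::16]];
  node 6 28 [::3;3;4;17] [::[::0;1;2;3]] [::(1,1)] 44 [::[::4];[::7];[::10]]
    44 [::[::4];[::7];[::10]] 44 [::[::4];[::7];[::10]];
  node 6 31 [::1;2;3;2;4;17] [::[::0;3;4;5];[::1;2;4;5]] [::(1,0);(1,1);(0,3)]
    44 [::[::10];[::13];[::16]] 44 [::[::8];[::13];[::16]] 44 [::[::8];[::13];
    [::16]];
  node 6 28 [::4;2;4;17] [::[::0;1;2;3]] [::(1,3);(1,0)] 44 [::[::3;4];[::7];
    [::10]] 44 [::[::2];[::7];[::10]] 44 [::[::2];[::7];[::10]];
  node 7 31 [::5;5;4;17] [::[::0;1;2;3]] [::(1,2);(3,2)] 93 [::[::0;1];[::3];
    [::7];[::10]] 94 [::[::0];[::2];[::3];[::5];[::7];[::10]] 95 [::[::1;2];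
    [::5];[::7];[::10]];
  node 8 38 [::5;5;11;17] [::[::0;1;2;3]] [::(0,0);(0,0);(4,4)] 96 [::[::1];
    [::4];[::6];[::10]] 96 [::[::1];[::4];[::7];[::10]] 96 [::[::1];[::4];
    [::8];[::10]];
  node 9 62 [::6;5;6;3;11;3;11;17] [::[::0;5;6;7];[::1;4;6;7];[::2;3;6;7]]
    [::(6,0);(0,0);(0,6);(0,0);(3,3)] 92 [::[::0];[::4];[::16];[::12];[::19];
    [::22]] 97 [::[::4];[::13];[::19];[::22]] 92 [::[::8];[::4];[::10];[::14];
    [::19];[::22]];
  node 10 62 [::17;17;11;17] [::[::0;1;2;3]] [::(6,6);(3,3)] 91 [::[::0];
    [::1];[::3];[::4];[::7];[::10]] 98 [::[::0];[::1];[::2];[::3];[::4];[::5];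
    [::7];[::10]] 91 [::[::2];[::1];[::5];[::4];[::7];[::10]];
  node 11 65 [::3;11;17;17;17] [::[::0;1;2;3;4]] [::(1,1)] 99 [::[::7];[::10];
    [::4];[::13]] 99 [::[::7];[::10];[::4];[::13]] 99 [::[::7];[::10];[::4];
    [::13]];
  node 12 81 [::6;5;3;11;17;17;17] [::[::0;2;4;5;6];[::0;3;4;5;6];[::1;2;4;5;
    6]] [::(0,3);(0,0);(0,3);(11,0)] 100 [::[::1];[::9];[::13];[::16];[::19]]
    100 [::[::2];[::9];[::13];[::16];[::19]] 100 [::[::8];[::1;2;4];[::13];
    [::16];[::19]];
  node 11 68 [::6;5;3;3;17;17;17] [::[::0;2;4;5;6];[::1;3;4;5;6]] [::(0,0);
    (0,0);(1,1);(1,1)] 99 [::[::13];[::16];[::1;4];[::19]] 99 [::[::13];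
    [::16];[::1;4];[::19]] 99 [::[::13];[::16];[::1;4];[::19]];
  node 4 14 [::1;1;1;1;5;5] [::[::0;2;4;5];[::0;3;4;5];[::1;2;4;5]] [::(0,0);
    (1,0);(0,0);(0,1)] 10 [::[::13];[::16]] 10 [::[::13];[::16]] 10 [::[::13];
    [::16]];
  node 5 18 [::2;2;2;5;5] [::[::0;1;2;3;4]] [::(1,1);(1,0);(0,1)] 103
    [::[::3];[::4];[::7];[::8];[::10];[::13]] 16 [::[::7;8];[::10];[::13]] 103
    [::[::4];[::3];[::8];[::7];[::10];[::13]];
  node 6 20 [::2;2;5;5;6] [::[::0;1;2;3;4]] [::(0,0);(0,0);(0,0);(0,0);(2,2)]
    104 [::[::1];[::4];[::12];[::7];[::10]] 104 [::[::1];[::4];[::13];[::7];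
    [::10]] 104 [::[::1];[::4];[::14];[::7];[::10]];
  node 7 31 [::2;2;5;5;17] [::[::0;1;2;3;4]] [::(0,0);(0,0);(0,0);(0,0);(6,6)]
    105 [::[::1];[::4];[::7];[::10];[::12]] 105 [::[::1];[::4];[::7];[::10];
    [::13]] 105 [::[::1];[::4];[::7];[::10];[::14]];
  node 8 35 [::2;5;5;6;17] [::[::0;1;2;3;4]] [::(0,0);(0,0);(0,0);(2,2)] 106
    [::[::1];[::9];[::4];[::7];[::13]] 106 [::[::1];[::10];[::4];[::7];[::13]]
    106 [::[::1];[::11];[::4];[::7];[::13]];
  node 9 46 [::2;5;5;17;17] [::[::0;1;2;3;4]] [::(0,0);(0,0);(0,0);(6,6)] 107
    [::[::1];[::4];[::7];[::9];[::13]] 107 [::[::1];[::4];[::7];[::10];[::13]]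
    107 [::[::1];[::4];[::7];[::11];[::13]];
  node 10 50 [::5;5;6;17;17] [::[::0;1;2;3;4]] [::(0,0);(0,0);(2,2)] 108
    [::[::6];[::1];[::4];[::10];[::13]] 108 [::[::7];[::1];[::4];[::10];
    [::13]] 108 [::[::8];[::1];[::4];[::10];[::13]];
  node 11 61 [::5;5;17;17;17] [::[::0;1;2;3;4]] [::(0,0);(0,0);(6,6)] 109
    [::[::1];[::4];[::6];[::10];[::13]] 109 [::[::1];[::4];[::7];[::10];
    [::13]] 109 [::[::1];[::4];[::8];[::10];[::13]];
  node 12 85 [::6;5;6;3;11;3;17;17;17] [::[::0;5;6;7;8];[::1;4;6;7;8];[::2;3;
    6;7;8]] [::(6,0);(0,0);(0,6);(0,0);(3,3)] 102 [::[::0];[::4];[::16];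
    [::12];[::19];[::22];[::25]] 110 [::[::4];[::13];[::19];[::22];[::25]] 102
    [::[::8];[::4];[::10];[::14];[::19];[::22];[::25]];
  node 13 85 [::17;17;17;17;17] [::[::0;1;2;3;4]] [::(6,6);(3,3)] 101
    [::[::0];[::1];[::3];[::4];[::7];[::10];[::13]] 111 [::[::0];[::1];[::2];
    [::3];[::4];[::5];[::7];[::10];[::13]] 101 [::[::2];[::1];[::5];[::4];
    [::7];[::10];[::13]];
  node 12 75 [::6;4;3;10;16;16;16] [::[::0;2;4;5;6];[::0;3;4;5;6];[::1;2;4;5;
    6]] [::(0,3);(0,0);(0,3);(10,0)] 100 [::[::1];[::9];[::13];[::16];[::19]]
    100 [::[::2];[::9];[::13];[::16];[::19]] 100 [::[::8];[::1;2;4];[::13];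
    [::16];[::19]];
  node 12 80 [::6;4;6;3;10;3;16;16;16] [::[::0;5;6;7;8];[::1;4;6;7;8];[::2;3;
    6;7;8]] [::(6,0);(0,0);(0,6);(0,0);(3,3)] 102 [::[::0];[::4];[::16];
    [::12];[::19];[::22];[::25]] 110 [::[::4];[::13];[::19];[::22];[::25]] 102
    [::[::8];[::4];[::10];[::14];[::19];[::22];[::25]];
  node 13 80 [::16;16;16;16;16] [::[::0;1;2;3;4]] [::(6,6);(3,3)] 113
    [::[::0];[::1];[::3];[::4];[::7];[::10];[::13]] 114 [::[::0];[::1];[::2];
    [::3];[::4];[::5];[::7];[::10];[::13]] 113 [::[::2];[::1];[::5];[::4];
    [::7];[::10];[::13]];
  node 3 16 [::2;13] [::[::0;1]] [::(1,1);(4,5)] 39 [::[::3;4]] 39 [::[::3;5]]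
    39 [::[::4;5]];
  node 4 18 [::2;3;13] [::[::0;1;2]] [::(0,0);(1,1)] 116 [::[::1];[::7]] 116
    [::[::1];[::7]] 116 [::[::1];[::7]];
  node 5 23 [::2;8;13] [::[::0;1;2]] [::(0,0);(3,3)] 117 [::[::1];[::3];[::7]]
    117 [::[::1];[::4];[::7]] 117 [::[::1];[::5];[::7]];
  node 4 20 [::2;2;1;2;13] [::[::0;3;4];[::1;2;4]] [::(0,0);(0,0);(1,0);(0,1)]
    116 [::[::4];[::13]] 116 [::[::1];[::13]] 116 [::[::1];[::13]];
  node 5 26 [::2;2;4;5;13] [::[::0;3;4];[::1;2;4]] [::(0,0);(0,0);(3,1);(0,2)]
    117 [::[::4];[::6];[::13]] 117 [::[::1];[::10];[::13]] 119 [::[::1];[::4];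
    [::8];[::11];[::13]];
  node 5 24 [::2;9;13] [::[::0;1;2]] [::(0,0);(3,3)] 117 [::[::1];[::3];[::7]]
    117 [::[::1];[::4];[::7]] 117 [::[::1];[::5];[::7]];
  node 6 31 [::4;13;13] [::[::0;1;2]] [::(2,2);(4,5)] 118 [::[::0];[::3;4];
    [::7]] 120 [::[::0];[::2];[::3];[::5];[::7]] 121 [::[::2];[::4;5];[::7]];
  node 7 33 [::3;4;13;13] [::[::0;1;2;3]] [::(1,1)] 122 [::[::4];[::7];[::10]]
    122 [::[::4];[::7];[::10]] 122 [::[::4];[::7];[::10]];
  node 8 38 [::4;8;13;13] [::[::0;1;2;3]] [::(0,0);(3,3)] 123 [::[::3];[::1];
    [::7];[::10]] 123 [::[::4];[::1];[::7];[::10]] 123 [::[::5];[::1];[::7];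
    [::10]];
  node 7 37 [::4;4;1;2;13;13] [::[::0;3;4;5];[::1;2;4;5]] [::(0,0);(0,0);
    (1,0);(0,1)] 122 [::[::4];[::13];[::16]] 122 [::[::1];[::13];[::16]] 122
    [::[::1];[::13];[::16]];
  node 8 43 [::4;4;4;5;13;13] [::[::0;3;4;5];[::1;2;4;5]] [::(0,0);(0,0);
    (3,1);(0,2)] 123 [::[::6];[::4];[::13];[::16]] 123 [::[::10];[::1];[::13];
    [::16]] 125 [::[::1];[::4];[::8];[::11];[::13];[::16]];
  node 8 39 [::4;9;13;13] [::[::0;1;2;3]] [::(0,0);(3,3)] 123 [::[::3];[::1];
    [::7];[::10]] 123 [::[::4];[::1];[::7];[::10]] 123 [::[::5];[::1];[::7];
    [::10]];
  node 9 48 [::8;13;13;13] [::[::0;1;2;3]] [::(4,4);(4,5)] 124 [::[::0];[::3;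
    4];[::7];[::10]] 126 [::[::0];[::2];[::3];[::5];[::7];[::10]] 127
    [::[::2];[::4;5];[::7];[::10]];
  node 10 50 [::3;8;13;13;13] [::[::0;1;2;3;4]] [::(1,1)] 128 [::[::4];[::7];
    [::10];[::13]] 128 [::[::4];[::7];[::10];[::13]] 128 [::[::4];[::7];
    [::10];[::13]];
  node 11 54 [::7;8;13;13;13] [::[::0;1;2;3;4]] [::(3,3)] 129 [::[::0];[::4];
    [::7];[::10];[::13]] 128 [::[::4];[::7];[::10];[::13]] 129 [::[::2];[::4];
    [::7];[::10];[::13]];
  node 10 55 [::7;6;2;1;13;13;13] [::[::0;2;4;5;6];[::1;3;4;5;6]] [::(0,0);
    (0,0);(1,1)] 128 [::[::1];[::13];[::16];[::19]] 128 [::[::4];[::13];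
    [::16];[::19]] 128 [::[::1];[::13];[::16];[::19]];
  node 11 61 [::7;6;5;4;13;13;13] [::[::0;2;4;5;6];[::1;3;4;5;6]] [::(0,0);
    (0,0);(3,0);(0,3)] 129 [::[::6];[::1];[::13];[::16];[::19]] 131 [::[::1];
    [::4];[::7];[::10];[::13];[::16];[::19]] 129 [::[::11];[::4];[::13];
    [::16];[::19]];
  node 6 31 [::2;13;2;13] [::[::0;1;2;3]] [::(1,1);(4,5)] 118 [::[::7];[::3;
    4];[::10]] 121 [::[::7];[::3;5];[::10]] 121 [::[::7];[::4;5];[::10]];
  node 7 33 [::2;5;13;13] [::[::0;1;2;3]] [::(0,0);(2,2)] 133 [::[::1];[::7];
    [::3];[::10]] 122 [::[::1];[::7];[::10]] 133 [::[::1];[::7];[::5];[::10]];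
  node 8 41 [::2;13;13;13] [::[::0;1;2;3]] [::(0,0);(5,5)] 134 [::[::1];[::3];
    [::7];[::10]] 123 [::[::1];[::4];[::7];[::10]] 134 [::[::1];[::5];[::7];
    [::10]];
  node 9 44 [::2;3;13;13;13] [::[::0;1;2;3;4]] [::(0,0);(1,1)] 135 [::[::1];
    [::7];[::10];[::13]] 135 [::[::1];[::7];[::10];[::13]] 135 [::[::1];[::7];
    [::10];[::13]];
  node 10 50 [::2;9;13;13;13] [::[::0;1;2;3;4]] [::(0,0);(3,3)] 136 [::[::1];
    [::3];[::7];[::10];[::13]] 136 [::[::1];[::4];[::7];[::10];[::13]] 136
    [::[::1];[::5];[::7];[::10];[::13]];
  node 11 54 [::6;9;13;13;13] [::[::0;1;2;3;4]] [::(2,2)] 137 [::[::0];[::4];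
    [::7];[::10];[::13]] 137 [::[::1];[::4];[::7];[::10];[::13]] 137 [::[::2];
    [::4];[::7];[::10];[::13]];
  node 12 65 [::13;13;13;13;13] [::[::0;1;2;3;4]] [::(7,6);(4,5)] 130
    [::[::0];[::3;4];[::7];[::10];[::13]] 132 [::[::0];[::2];[::5];[::3];
    [::7];[::10];[::13]] 138 [::[::2];[::4;5];[::7];[::10];[::13]];
  node 7 35 [::2;2;3;6;11;11] [::[::0;3;4;5];[::1;2;4;5]] [::(0,0);(0,0);
    (3,0);(0,3)] 80 [::[::4];[::6];[::13];[::16]] 80 [::[::1];[::10];[::13];
    [::16]] 80 [::[::1];[::11];[::13];[::16]];
  node 7 32 [::2;2;3;2;1;11;11] [::[::0;2;3;5;6];[::1;2;4;5;6]] [::(0,0);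
    (0,0);(1,1)] 82 [::[::1];[::4];[::13];[::10];[::16];[::19]] 82 [::[::1];
    [::4];[::13];[::10];[::16];[::19]] 82 [::[::1];[::4];[::13];[::10];[::16];
    [::19]];
  node 8 45 [::2;2;3;6;2;1;11;11] [::[::0;2;4;6;7];[::0;2;5;6;7];[::0;3;4;6;
    7];[::1;2;4;6;7]] [::(0,2);(2,0);(0,0);(6,0);(1,1);(1,0)] 140 [::[::2];
    [::3];[::7];[::9];[::19];[::22]] 141 [::[::2];[::3];[::7];[::12;15];
    [::14];[::19];[::22]] 84 [::[::2];[::7;9];[::19];[::22]];
  node 9 45 [::2;2;3;6;6;3;11;11] [::[::0;2;4;6;7];[::0;2;5;6;7];[::0;3;4;6;
    7];[::1;2;4;6;7]] [::(0,0);(0,0);(0,0);(0,0);(2,2);(1,1)] 142 [::[::1];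
    [::4];[::7];[::10];[::12];[::15];[::19];[::22]] 142 [::[::1];[::4];[::7];
    [::10];[::13];[::16];[::19];[::22]] 142 [::[::1];[::4];[::7];[::10];
    [::14];[::17];[::19];[::22]];
  node 8 41 [::2;2;3;6;2;3;1;11;11] [::[::0;2;6;7;8];[::0;4;5;7;8];[::1;3;5;7;
    8]] [::(0,0);(0,0);(1,1);(0,0);(0,0);(1,1)] 140 [::[::4];[::1];[::6;13];
    [::10];[::22];[::25]] 140 [::[::4];[::1];[::7;13];[::10];[::22];[::25]]
    140 [::[::4];[::1];[::8;13];[::10];[::22];[::25]];
  node 7 30 [::2;3;3;11;11] [::[::0;1;2;3;4]] [::(0,0);(1,1)] 80 [::[::1];
    [::7];[::10];[::13]] 80 [::[::1];[::7];[::10];[::13]] 80 [::[::1];[::7];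
    [::10];[::13]];
  node 8 38 [::2;2;3;6;3;11;11] [::[::0;3;4;5;6];[::1;2;4;5;6]] [::(0,0);
    (0,0);(3,0);(0,3)] 145 [::[::4];[::6];[::13];[::16];[::19]] 145 [::[::1];
    [::10];[::13];[::16];[::19]] 145 [::[::1];[::11];[::13];[::16];[::19]];
  node 9 48 [::2;2;3;6;2;6;3;2;11;11] [::[::0;2;7;8;9];[::0;3;6;8;9];[::0;4;5;
    8;9];[::1;2;6;8;9];[::1;3;5;8;9]] [::(0,0);(0,0);(0,0);(0,0);(0,0);(3,3);
    (0,0);(1,1)] 144 [::[::1];[::4];[::7];[::10];[::13];[::15];[::21];[::25];
    [::28]] 146 [::[::1];[::4];[::7];[::10];[::19];[::25];[::28]] 144
    [::[::1];[::4];[::7];[::10];[::13];[::17];[::23];[::25];[::28]];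
  node 7 35 [::2;2;1;8;11;11] [::[::0;3;4;5];[::1;2;4;5]] [::(0,0);(0,0);
    (1,0);(2,3)] 82 [::[::1];[::4];[::6];[::9];[::13];[::16]] 80 [::[::1];
    [::10];[::13];[::16]] 80 [::[::1];[::11];[::13];[::16]];
  node 8 44 [::2;2;3;8;1;1;11;11] [::[::0;3;4;6;7];[::0;3;5;6;7];[::1;2;4;6;
    7];[::1;3;4;6;7]] [::(2,0);(0,0);(1,1);(0,8);(0,0);(1,0)] 148 [::[::0];
    [::4];[::6];[::11];[::19];[::22]] 148 [::[::0];[::4];[::7];[::11];[::19];
    [::22]] 84 [::[::4];[::8;11];[::19];[::22]];
  node 8 46 [::2;2;9;2;5;3;1;11;11] [::[::0;3;5;7;8];[::1;2;6;7;8];[::1;3;4;7;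
    8];[::1;3;6;7;8]] [::(0,0);(0,0);(8,1);(1,0);(0,5);(0,3)] 84 [::[::4];
    [::6;9];[::22];[::25]] 140 [::[::4];[::1];[::17];[::14;19];[::22];[::25]]
    140 [::[::4];[::1];[::17];[::14;19];[::22];[::25]];
  node 7 31 [::2;2;4;11;11] [::[::0;1;2;3;4]] [::(0,0);(1,1);(1,2)] 80
    [::[::1];[::6;7];[::10];[::13]] 80 [::[::1];[::6;8];[::10];[::13]] 80
    [::[::1];[::7;8];[::10];[::13]];
  node 8 37 [::2;6;2;1;3;11;11] [::[::0;1;4;5;6];[::0;2;3;5;6];[::0;2;4;5;6]]
    [::(0,0);(3,0);(0,2)] 145 [::[::1];[::3];[::13];[::16];[::19]] 145
    [::[::1];[::4];[::13];[::16];[::19]] 151 [::[::1];[::8];[::10;13];[::16];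
    [::19]];
  node 9 49 [::2;2;3;6;2;6;3;2;11;11] [::[::0;3;7;8;9];[::0;4;6;8;9];[::0;4;7;
    8;9];[::1;2;7;8;9];[::1;3;6;8;9];[::1;3;7;8;9];[::1;4;5;8;9];[::1;4;6;8;
    9];[::1;4;7;8;9]] [::(2,0);(0,0);(0,0);(0,0);(0,0);(0,1);(0,3);(1,0)] 149
    [::[::0];[::4];[::7];[::10;13];[::21];[::22];[::25];[::28]] 150 [::[::0];
    [::4];[::7;10];[::13];[::16];[::20];[::22];[::25];[::28]] 152 [::[::4];
    [::10];[::13];[::17];[::20];[::25];[::28]];
  node 10 51 [::4;11;11;11;11] [::[::0;1;2;3;4]] [::(0,2);(3,2);(6,2)] 143
    [::[::1];[::2];[::3];[::4];[::6];[::7];[::10];[::13]] 147 [::[::1];[::2];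
    [::3];[::4];[::5];[::6];[::7];[::8];[::10];[::13]] 153 [::[::1];[::2];
    [::3];[::4];[::5];[::6];[::7];[::8];[::10];[::13]];
  node 11 55 [::11;11;11;11;11] [::[::0;1;2;3;4]] [::(4,4)] 154 [::[::0];
    [::4];[::7];[::10];[::13]] 154 [::[::1];[::4];[::7];[::10];[::13]] 154
    [::[::2];[::4];[::7];[::10];[::13]];
  node 10 43 [::3;10;10;10;10] [::[::0;1;2;3;4]] [::(1,1)] 87 [::[::4];[::7];
    [::10];[::13]] 87 [::[::4];[::7];[::10];[::13]] 87 [::[::4];[::7];[::10];
    [::13]];
  node 7 30 [::5;5;5;5;5;5] [::[::0;2;4;5];[::0;3;4;5];[::1;2;4;5]] [::(0,0);
    (5,0);(0,0);(0,5)] 24 [::[::3];[::7];[::13];[::16]] 24 [::[::1];[::7];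
    [::13];[::16]] 24 [::[::1];[::11];[::13];[::16]];
  node 7 30 [::5;5;5;5;5;5] [::[::0;2;4;5];[::1;3;4;5]] [::(0,0);(0,0);(5,0);
    (0,5)] 24 [::[::1];[::6];[::13];[::16]] 0 [::] 24 [::[::4];[::11];[::13];
    [::16]];
  node 8 32 [::2;10;10;5;5] [::[::0;1;2;3;4]] [::(1,1);(5,0);(0,5)] 157
    [::[::3];[::4];[::7];[::8];[::10];[::13]] 158 [::[::3];[::4];[::7];[::8];
    [::10];[::13]] 157 [::[::4];[::3];[::8];[::7];[::10];[::13]];
  node 9 42 [::2;5;5;5;5;10;10] [::[::0;1;3;5;6];[::0;1;4;5;6];[::0;2;3;5;6]]
    [::(0,0);(0,0);(5,0);(0,0);(0,5)] 159 [::[::1];[::16];[::19];[::6];[::10]]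
    159 [::[::1];[::16];[::19];[::4];[::10]] 159 [::[::1];[::16];[::19];[::4];
    [::14]];
  node 9 44 [::2;2;5;5;5;5;10;10] [::[::0;3;5;6;7];[::1;2;4;6;7]] [::(0,0);
    (0,0);(0,0);(0,0);(5,0);(0,5)] 159 [::[::4];[::19];[::22];[::7];[::12]] 0
    [::] 159 [::[::1];[::19];[::22];[::10];[::17]];
  node 10 44 [::4;10;10;10;10] [::[::0;1;2;3;4]] [::(2,2);(5,0);(0,5)] 160
    [::[::0];[::3];[::4];[::7];[::8];[::10];[::13]] 161 [::[::0];[::2];[::3];
    [::4];[::7];[::8];[::10];[::13]] 160 [::[::2];[::4];[::3];[::8];[::7];
    [::10];[::13]];
  node 11 50 [::10;10;10;10;10] [::[::0;1;2;3;4]] [::(3,3)] 156 [::[::0];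
    [::4];[::7];[::10];[::13]] 162 [::[::1];[::4];[::7];[::10];[::13]] 156
    [::[::2];[::4];[::7];[::10];[::13]];
  node 3 13 [::1;1;4;3;2] [::[::0;2;4];[::0;3;4];[::1;2;4]] [::(0,0);(0,1);
    (2,0);(2,1)] 9 [::[::13];[::6;9]] 9 [::[::13];[::6;7]] 7 [::[::13];[::7;
    11]];
  node 2 12 [::3;1;5;1] [::[::0;3];[::1;2];[::1;3]] [::(0,0);(1,0);(0,2);
    (0,1)] 6 [::[::7]] 6 [::[::8;11]] 6 [::[::1]];
  node 3 17 [::5;1;4;3] [::[::0;2];[::1;2];[::1;3]] [::(0,3);(0,0);(3,1);
    (0,3)] 7 [::[::1;4];[::6]] 7 [::[::2];[::6]] 165 [::[::11];[::8];[::1;2];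
    [::4]];
  node 4 20 [::2;1;4;3;2;5] [::[::0;2;4];[::0;2;5];[::0;3;4];[::1;2;4]]
    [::(1,1);(1,0);(0,0);(0,0);(1,0);(0,5)] 164 [::[::0];[::3];[::7];[::10];
    [::12;13]] 166 [::[::17];[::12];[::7];[::10]] 166 [::[::17];[::13];[::7];
    [::10]];
  node 2 9 [::3;1;2;3] [::[::0;2];[::1;3]] [::(2,0);(0,1);(1,1);(1,2)] 6
    [::[::0;1]] 6 [::[::0;5]] 6 [::[::8;11]];
  node 3 15 [::4;3;2;5] [::[::0;3];[::1;2]] [::(0,1);(0,3);(2,0);(3,2)] 7
    [::[::1];[::9]] 168 [::[::5];[::2];[::6];[::9]] 9 [::[::11];[::1;2]];
  node 3 11 [::3;2;4] [::[::0;1;2]] [::(1,1);(0,2);(4,0)] 9 [::[::5];[::6]] 9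
    [::[::5];[::6]] 9 [::[::5];[::6]];
  node 4 25 [::6;1;4;3;2;5] [::[::0;2;4];[::1;2;5];[::1;3;4]] [::(3,1);(1,0);
    (0,0);(3,0);(0,2)] 169 [::[::7];[::9];[::14];[::16]] 170 [::[::0];[::14];
    [::7]] 170 [::[::1;2];[::14];[::7]];
  node 5 33 [::5;2;1;1;4;3;2;5] [::[::0;2;4;6];[::0;2;4;7];[::0;2;5;6];[::0;3;
    4;6];[::1;2;4;6]] [::(2,2);(2,0);(0,1);(1,0);(0,0);(3,0);(0,0);(5,0)] 167
    [::[::0];[::1];[::13];[::15];[::19];[::21]] 171 [::[::0;2;3];[::1];[::13];
    [::15];[::19];[::21]] 167 [::[::2];[::1];[::13];[::15];[::19];[::21]];
  node 2 8 [::1;4;2;1] [::[::0;3];[::1;2]] [::(0,0);(1,2);(1,1);(1,0)] 6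
    [::[::1;3;4]] 6 [::[::3;5]] 6 [::[::4;5]];
  node 2 12 [::1;2;1;2;3;1] [::[::0;5];[::1;4];[::2;3]] [::(1,0);(0,1);(0,0);
    (2,0)] 6 [::[::9;16]] 6 [::[::13]] 6 [::[::13]];
  node 3 14 [::1;5;5;2] [::[::0;3];[::1;2]] [::(1,0);(2,1);(2,3);(1,1)] 173
    [::[::0];[::3;4];[::6];[::9]] 174 [::[::0];[::3];[::5];[::6];[::8];[::11]]
    7 [::[::4;5];[::8]];
  node 4 17 [::5;2;2;2;5] [::[::0;2;3];[::0;2;4];[::1;2;3]] [::(5,0);(1,1);
    (0,1);(2,0);(0,5)] 15 [::[::7;8];[::9];[::0;3]] 175 [::[::5];[::0];[::14];
    [::9]] 175 [::[::5];[::0];[::14];[::9]];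
  node 2 10 [::2;3;1;2] [::[::0;2];[::0;3];[::1;2]] [::(1,0);(0,3)] 6 [::[::7;
    10]] 6 [::[::7;10]] 6 [::[::5]];
  node 3 13 [::1;3;2;2;5] [::[::0;3];[::0;4];[::1;4];[::2;3]] [::(0,0);(3,0);
    (0,0);(0,2);(2,3)] 9 [::[::12];[::1;3]] 7 [::[::3];[::14]] 177 [::[::11];
    [::14];[::1];[::7]];
  node 4 17 [::5;2;1;1;2;5] [::[::0;2;5];[::0;3;4];[::0;3;5];[::1;2;4];[::1;2;
    5];[::1;3;4]] [::(1,1);(2,0);(0,1);(1,0);(0,2)] 178 [::[::0];[::1];[::3];
    [::14];[::16]] 169 [::[::0;2;3];[::1];[::14];[::16]] 178 [::[::2];[::1];
    [::3];[::14];[::16]];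
  node 5 20 [::5;2;3;3;2;5] [::[::0;2;5];[::0;3;4];[::0;3;5];[::1;2;4];[::1;2;
    5];[::1;3;4]] [::(0,0);(0,0);(0,1);(2,1)] 176 [::[::1];[::4];[::9];[::13];
    [::16]] 176 [::[::16];[::13];[::7];[::4];[::1]] 179 [::[::1];[::4];[::8];
    [::11];[::13];[::16]];
  node 6 33 [::7;2;7;7] [::[::0;1;2;3]] [::(5,2);(1,1);(3,3);(2,5)] 172
    [::[::0];[::2];[::3];[::5];[::6;7];[::8];[::9];[::11]] 180 [::[::0];[::2];
    [::6];[::8];[::9];[::11]] 172 [::[::11];[::9];[::5];[::3];[::7;8];[::6];
    [::2];[::0]];
  node 7 33 [::6;7;7;7] [::[::0;1;2;3]] [::(2,2);(7,0);(0,7)] 181 [::[::3];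
    [::0];[::8];[::10]] 181 [::[::3];[::1];[::8];[::10]] 181 [::[::3];[::2];
    [::8];[::10]];
  node 8 34 [::6;7;3;7;7] [::[::0;1;2;3;4]] [::(0,0);(0,0);(1,1)] 182
    [::[::1];[::4];[::10];[::13]] 182 [::[::1];[::4];[::10];[::13]] 182
    [::[::1];[::4];[::10];[::13]];
  node 8 34 [::6;1;7;3;2;7;7] [::[::0;2;4;5;6];[::1;2;3;5;6]] [::(0,0);(0,0);
    (0,0);(0,0);(1,1)] 182 [::[::1];[::7];[::16];[::19]] 182 [::[::10];[::7];
    [::16];[::19]] 182 [::[::1];[::7];[::16];[::19]];
  node 7 34 [::3;7;2;7;7] [::[::0;1;2;3;4]] [::(2,1);(0,0);(1,0);(0,0);(0,7)]
    181 [::[::4];[::0];[::10];[::14]] 181 [::[::4];[::0];[::10];[::14]] 181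
    [::[::4];[::6;7];[::10];[::14]];
  node 7 34 [::1;1;7;2;2;7;7] [::[::0;2;4;5;6];[::1;2;3;5;6];[::1;2;4;5;6]]
    [::(0,1);(0,0);(0,0);(2,0)] 181 [::[::7];[::9];[::16];[::19]] 181
    [::[::7];[::13];[::16];[::19]] 181 [::[::7];[::13];[::16];[::19]];
  node 7 34 [::2;7;2;7;7] [::[::0;1;2;3;4]] [::(1,1)] 181 [::[::4];[::7];
    [::10];[::13]] 0 [::] 181 [::[::4];[::7];[::10];[::13]];
  node 8 34 [::6;1;7;2;2;7;7] [::[::0;2;4;5;6];[::1;2;3;5;6];[::1;2;4;5;6]]
    [::(3,2)] 185 [::[::0];[::7];[::13];[::16];[::19]] 186 [::[::1];[::4];
    [::7];[::10];[::13];[::16];[::19]] 187 [::[::2];[::7];[::13];[::16];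
    [::19]];
  node 9 35 [::7;7;7;7;7] [::[::0;1;2;3;4]] [::(0,1);(0,7);(3,2);(7,0)] 183
    [::[::1];[::5];[::6];[::9];[::13]] 184 [::[::1];[::2];[::5];[::6];[::7];
    [::9];[::13]] 188 [::[::1];[::2];[::5];[::7];[::8];[::9];[::13]]
].

Lemma table_checked : check_table table.
Proof. by vm_compute. Qed.

(** * Sets of equal size *)

Section EqualSizes.
Variables m n : nat.
Local Notation nn := (fun _ : 'I_m => n).
Implicit Types (D : 'I_m -> {set 'I_n}) (v : 'I_m -> nat).

Definition coin_of (i : 'I_m) (x : 'I_n) : coin nn := existT _ i x.

Lemma coin_of_inj i : injective (coin_of i).
Proof. by move=> x y /(congr1 (fun c : coin nn => tagged c : 'I_n)). Qed.

Definition in_box D (X : config nn) := forall i, X i \in D i.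

(** Arbitrary subsets [D i] are allowed, so that what remains of a box after splitting one of its
    factors is again such a box. *)
Definition box_solvable v t :=
  forall D, (forall i, #|D i| <= v i) -> solves (in_box D) t.

(** Here [W] is the set of all [m * n] coins: those outside the box are genuine ballast, and
    [determined] is immediate. *)
Lemma box_valid e b :
  valid nn e -> sizes e = nseq m b -> iota 0 m \in states e ->
  supply e <= m * n -> box_solvable (fun=> b) (weighings e).
Proof.
move=> ve sz st sup D Db.
have lab : labels e = iota 0 m by rewrite /labels sz size_nseq.
pose B (j : nat) : {set coin nn} :=
  [set c : coin nn | (nat_of_ord (tag c) == j) && (tagged c \in D (tag c))].
apply: (ve setT B); rewrite ?lab.
- by rewrite cardsT card_tagged sumnE big_map big_enum /= sum_nat_const !card_ord.
- by move=> j _; apply: subsetT.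
- apply: disjoint_onP => i j c _ _; rewrite !inE => /andP[/eqP<- _] /andP[/eqP<- _].
  by [].
- move=> j; rewrite mem_iota add0n => /= ltjm; rewrite sz nth_nseq ltjm.
  pose i := Ordinal ltjm; apply: leq_trans (Db i).
  apply: leq_trans (_ : #|[set coin_of i x | x in D i]| <= _).
    apply: subset_leq_card; apply/subsetP => -[k x]; rewrite inE /= => /andP[/eqP kj xD].
    have ki : k = i by apply: val_inj.
    by move: x xD; rewrite ki => x xD; apply/imsetP; exists x.
  exact: leq_imset_card.
- move=> X XD; exists (iota 0 m) => //; split=> [j|].
    move=> js; rewrite js; move: js; rewrite mem_iota add0n => /= ltjm.
    pose i := Ordinal ltjm; rewrite -(cards1 (coin_of i (X i))).
    congr #|pred_of_set _|; apply/setP => -[k x]; rewrite !inE /=.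
    apply/andP/eqP => [[/andP[/eqP kj _] /eqP <-]|eqc].
      by have -> : k = i by apply: val_inj.
    have ki : k = i by case: eqc.
    have xX : x = X i := congr1 (fun c : coin nn => tagged c : 'I_n) eqc.
    by rewrite xX ki !eqxx XD.
  apply/subsetP => -[k x]; rewrite !inE /= => /eqP <-; rewrite in_bigcup_seq.
  by apply/hasP; exists (k : nat); rewrite ?mem_iota ?inE /= ?eqxx ?XD ?ltn_ord.
move=> X Y _ _; rewrite !setTI => eqXY; apply/ffunP => i.
have /setP/(_ (coin_of i (X i))) := eqXY.
by rewrite !inE /= eqxx => /esym/eqP.
Qed.

(** Both pans take equally many coins of [D i], whose only counterfeit coin then tips the balance
    towards the part containing it. *)
Lemma box_split v i t :
  box_solvable v t ->
  box_solvable (fun j => if j == i then 3 * v j else v j) t.+1.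
Proof.
(* With [a] capped by half of [d], the pans can be filled from [D i] itself. Since [d <= 3 * v i],
   the rest [d - 2 * a] is at most [v i] as well. *)
move=> sol D Dv; pose d := #|D i|; pose a := minn (v i) d./2.
have := Dv i; rewrite eqxx -/d => d3.
have aD : a + a <= #|D i| by rewrite -/d /a; lia.
pose pan k : {set coin nn} := [set coin_of i x | x in cut (D i) a a k].
have eq_pans : #|pan 0| = #|pan 2|.
  by rewrite !card_imset ?card_cut0 ?card_cut2 //; apply: coin_of_inj.
have load k (X : config nn) : #|pan k :&: counterfeits X| = (X i \in cut (D i) a a k).
  have [Xk|NXk] := boolP (X i \in _).
    apply: etrans (cards1 (coin_of i (X i))).
    congr #|pred_of_set _|; apply/setP => c; rewrite in_setI in_set1.
    apply/andP/eqP => [[/imsetP[x xk ->]]|->].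
      by rewrite inE /= => /eqP->.
    by rewrite inE /= eqxx; split=> //; apply: imset_f.
  apply/eqP; rewrite cards_eq0 -subset0; apply/subsetP => c /setIP[/imsetP[x xk ->]].
  by rewrite inE /= => /eqP Xx; rewrite Xx xk in NXk.
apply: (solves_weigh (w := Weighing eq_pans)) => o.
have part k : k < 3 -> solves (fun X => in_box D X /\ X i \in cut (D i) a a k) t.
  move=> k3; pose D' j := if j == i then cut (D i) a a k else D j.
  apply: solves_sub (sol D' _) => [X [XD Xk] j|j]; rewrite /D'; case: eqVneq => [->|ji] //.
    rewrite card_cut // -/d; move: k3 d3; rewrite /a; clear; case: k => [|[|[|]]] //=; lia.
  by have := Dv j; rewrite (negPf ji).
have cutD (X : config nn) : in_box D X ->
    exists2 k, k < 3 & forall l, (X i \in cut (D i) a a l) = (k == l).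
  move=> XD; exists (cut_index (D i) a a (X i)); first exact: cut_index_lt.
  by move=> l; rewrite inE XD.
rewrite !inE => /or3P[] /eqP->.
- apply: solves_sub (part 0 isT) => X [XD]; rewrite /outcome /= !load.
  by have [k _ kX] := cutD X XD; rewrite !kX; case: eqP; case: eqP.
- apply: solves_sub (part 1 isT) => X [XD]; rewrite /outcome /= !load.
  by have [k k3 kX] := cutD X XD; rewrite !kX; case: k k3 {kX} => [|[|[|]]].
- apply: solves_sub (part 2 isT) => X [XD]; rewrite /outcome /= !load.
  by have [k _ kX] := cutD X XD; rewrite !kX; case: eqP; case: eqP.
Qed.

Lemma box_solvable_leq v u t :
  (forall i, v i <= u i) -> box_solvable u t -> box_solvable v t.
Proof. by move=> vu sol D Dv; apply: sol => i; apply: leq_trans (vu i). Qed.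

Lemma box_split_all q t :
  box_solvable (fun=> q) t -> box_solvable (fun=> 3 * q) (t + m).
Proof.
(* The sets are treated one at a time; [r] counts those already enlarged to [3 * q]. *)
move=> sol; suff split_first r : r <= m ->
    box_solvable (fun i : 'I_m => if i < r then 3 * q else q) (t + r).
  by apply: (box_solvable_leq _ (split_first m (leqnn m))) => i; rewrite ltn_ord.
elim: r => [|r IHr] ltrm; first by rewrite addn0.
rewrite addnS; have := box_split (i := Ordinal ltrm) (IHr (ltnW ltrm)).
apply: box_solvable_leq => i.
by rewrite -val_eqE /=; do 3!case: ifP; lia.
Qed.

Lemma box_split_iter q t k :
  box_solvable (fun=> q) t -> box_solvable (fun=> q * 3 ^ k) (t + k * m).
Proof.
move=> sol; elim: k => [|k IHk]; first by rewrite muln1 addn0.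
have -> : t + k.+1 * m = t + k * m + m by lia.
by rewrite expnS mulnCA; apply: box_split_all.
Qed.

Lemma box_solvable1 : box_solvable (fun=> 1) 0.
Proof.
move=> D D1; exists (Stop nn); split=> // X Y XD YD _; apply/ffunP => i.
exact: (card_le1_eqP (D1 i)).
Qed.

Lemma g1_box q t : box_solvable (fun=> q) t -> n <= q -> g1_const m n <= t.
Proof.
move=> sol nq; rewrite /g1_const /g1; case: ex_minnP => s _; apply.
have [i|a [sza inja]] := sol (fun=> setT); first by rewrite cardsT card_ord.
have inT X : in_box (fun=> setT) X by move=> i; rewrite inE.
apply/asboolP; exists a; split=> [X|X Y]; first exact: sza.
exact: inja.
Qed.

Lemma g1_exp k : n <= 3 ^ k -> g1_const m n <= k * m.
Proof.
by move=> nk; apply: (g1_box (box_split_iter (k := k) box_solvable1)); rewrite mul1n.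
Qed.

(** A boolean search, so that each use is settled by evaluation. The supply is compared with
    [m * b], the number of coins in the smallest case [n = b]. *)
Definition tabulated b t := has (fun e =>
  [&& sizes e == nseq m b, iota 0 m \in states e, supply e <= m * b &
      weighings e == t]) table.

(** [b <= n] guarantees the supply of the tabulated entry; the factor [3 ^ k] comes from splitting
    every set [k] times. *)
Lemma g1_table b t k :
  tabulated b t -> b <= n <= b * 3 ^ k -> g1_const m n <= t + k * m.
Proof.
move=> /(has_nthP stop)[i ltis /and4P[/eqP sz st sup /eqP <-]] /andP[bn nb].
apply: g1_box nb; apply: box_split_iter; apply: box_valid sz st _.
  exact: check_table_valid table_checked ltis.
by apply: leq_trans sup _; rewrite leq_mul2l bn orbT.
Qed.

End EqualSizes.

Import Order.TTheory GRing.Theory Num.Theory.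

(** * Logarithms and the four bounds *)

(* The premise amounts to [k + a - d < log3 (n / c)]. *)
Definition log3_lower_bound (n c : nat) (x : int) := forall a d k : nat,
  c * 3 ^ a * 3 ^ k < n * 3 ^ d -> (k%:Z + a.+1%:Z - d%:Z <= x)%R.

(** Taking logarithms turns the premise into a strict inequality between an integer and
    [log3 (n / c)], so the ceiling exceeds that integer by at least one. Afterwards only integer
    arithmetic is needed. *)
Lemma ceil_log3_lower_bound (R : realType) (n c : nat) :
  0 < c -> log3_lower_bound n c (Num.ceil (log3 (n%:R / c%:R : R)%R)).
Proof.
move=> c0 a d k lt_n; have n0 : 0 < n by lia.
have ln3 : (0 < ln (3 : R))%R by apply: ln_gt0; rewrite ltr1n.
have pos (x : nat) : 0 < x -> (x%:R : R)%R \is Num.pos by rewrite posrE ltr0n.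
have lnX (x i : nat) : 0 < x -> ln ((x * 3 ^ i)%N%:R : R)%R = (ln x%:R + ln 3 *+ i)%R.
  by move=> x0; rewrite natrM natrX lnM ?posrE ?exprn_gt0 ?ltr0n // lnXn ?ltr0n.
suff lt_log : ((k + a)%N%:Z%:~R - d%:Z%:~R < log3 (n%:R / c%:R : R))%R.
  have := lt_le_trans lt_log (ceil_ge _); rewrite -rmorphB ltr_int; move: (Num.ceil _) => z; lia.
rewrite /log3 ltr_pdivlMr // ln_div ?pos // mulrBl !mulr_natl.
have : (ln ((c * 3 ^ (k + a))%N%:R : R) < ln ((n * 3 ^ d)%N%:R : R))%R.
  rewrite ltr_ln ?posrE ?ltr0n ?muln_gt0 ?c0 ?n0 ?expn_gt0 // ltr_nat.
  by rewrite expnD mulnCA mulnA mulnC mulnA in lt_n *.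
rewrite !lnX //; lra.
Qed.

(** Choosing the least exponent places [n] in one period [c * 3 ^ k < 3 * n <= 3 * c * 3 ^ k], apart
    from small [n] with [k = 0]. *)
Lemma least_power (c n : nat) : 0 < c ->
  exists2 k, n <= c * 3 ^ k & (k == 0) || (c * 3 ^ k < 3 * n).
Proof.
move=> c0; have ex : exists k, n <= c * 3 ^ k.
  by exists n; apply: leq_trans (ltnW (ltn_expl n (isT : 1 < 3))) _; rewrite leq_pmull.
case: (ex_minnP ex) => [[|k] nk min_k]; first by exists 0.
exists k.+1 => //=; rewrite expnS mulnCA ltn_pmul2l // ltnNge.
by apply/negP => /min_k; rewrite ltnn.
Qed.


(** For [n > 1] the right-hand side is at least [2 * k + 2], attained by pure splitting up to
    [3 * 3 ^ k], and at least [2 * k + 3] beyond, attained by the box of size 5. The box of size 4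
    serves [n = 4], too small for the supply of the other. *)
Lemma g1_const2 n x1 x5 : 0 < n ->
  log3_lower_bound n 1 x1 -> log3_lower_bound n 5 x5 ->
  ((g1_const 2 n)%:Z <= x1 + x5 + 1)%R.
Proof.
move=> n_gt0 lb1 lb5; have [n1|n1] := ltnP 1 n; last first.
  (* For [n = 1] the bound is tight: the ceilings are at least 0 and -1, as 1/5 exceeds 1/9. *)
  have := @g1_exp 2 n 0 n1; have := lb1 0 1 0; have := lb5 0 2 0; lia.
have [k] := least_power n (isT : 0 < 5).
have exp2 := @g1_exp 2 n k.+1; have t4 := @g1_table 2 n 4 3 k isT.
have t5 := @g1_table 2 n 5 3 k isT.
have := (lb1 1 0 k, lb1 0 0 k, lb5 0 1 k, lb5 0 0 k) => -[[[]]].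
move: exp2 t4 t5; rewrite expnS; case: k => [|k]; rewrite ?expnS /=; lia.
Qed.

(** In units of [3 ^ k], the ranges up to 3, 4 and 6 use pure splitting, the box of size 4, and the
    box of size 2 split once more. Each range allows one weighing more than the preceding one. *)
Lemma g1_const3 n x1 x4 x6 : 0 < n ->
  log3_lower_bound n 1 x1 ->
  log3_lower_bound n 4 x4 -> log3_lower_bound n 6 x6 ->
  ((g1_const 3 n)%:Z <= x1 + x4 + x6 + 2)%R.
Proof.
move=> n_gt0 lb1 lb4 lb6; have [n2|n2] := ltnP 2 n; last first.
  have := (lb1 0 1 0, lb1 0 0 0, lb4 0 2 0, lb4 0 1 0, lb6 0 2 0, lb6 0 2 0).
  have := (@g1_exp 3 n 0, @g1_table 3 n 2 2 0 isT).
  by case=> e0 t2 [[[[[]]]]]; lia.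
have [k] := least_power n (isT : 0 < 6).
have exp3 := @g1_exp 3 n k.+1; have t4 := @g1_table 3 n 4 4 k isT.
have t2 := @g1_table 3 n 2 2 k.+1 isT.
have := (lb1 1 0 k, lb1 0 0 k, lb4 0 1 k, lb4 0 0 k, lb6 0 1 k) => -[[[[]]]].
move: exp3 t2 t4; rewrite expnS; case: k => [|k]; rewrite ?expnS /=; lia.
Qed.

(** In units of [3 ^ k], the right-hand side gains one weighing on passing each of 9, 11 and 15; the
    four ranges up to 20 allow [4 * k] plus 8, 9, 10 and 11 weighings. *)
Lemma g1_const4 n x1 x5 x11 x20 : 0 < n ->
  log3_lower_bound n 1 x1 ->
  log3_lower_bound n 5 x5 -> log3_lower_bound n 11 x11 ->
  log3_lower_bound n 20 x20 ->
  ((g1_const 4 n)%:Z <= x1 + x5 + x11 + x20 + 5)%R.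
Proof.
move=> n_gt0 lb1 lb5 lb11 lb20; have [n6|n6] := ltnP 6 n; last first.
  case: n n_gt0 n6 lb1 lb5 lb11 lb20 => [|[|[|[|[|[|[|]]]]]]] // _ _ lb1 lb5 lb11 lb20.
  + have := (@g1_exp 4 1 0 isT, lb1 0 1 0 isT, lb5 0 2 0 isT,
      lb11 0 3 0 isT, lb20 0 3 0 isT) => -[[[[]]]]; lia.
  + have := (@g1_table 4 2 2 3 0 isT isT, lb1 0 0 0 isT, lb5 0 1 0 isT,
      lb11 0 2 0 isT, lb20 0 3 0 isT) => -[[[[]]]]; lia.
  + have := (@g1_exp 4 3 1 isT, lb1 0 0 0 isT, lb5 0 1 0 isT,
      lb11 0 2 0 isT, lb20 0 2 0 isT) => -[[[[]]]]; lia.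
  + have := (@g1_table 4 4 4 6 0 isT isT, lb1 1 0 0 isT, lb5 0 1 0 isT,
      lb11 0 1 0 isT, lb20 0 2 0 isT) => -[[[[]]]]; lia.
  + have := (@g1_table 4 5 5 6 0 isT isT, lb1 1 0 0 isT, lb5 0 1 0 isT,
      lb11 0 1 0 isT, lb20 0 2 0 isT) => -[[[[]]]]; lia.
  + have := (@g1_table 4 6 6 7 0 isT isT, lb1 1 0 0 isT, lb5 0 0 0 isT,
      lb11 0 1 0 isT, lb20 0 2 0 isT) => -[[[[]]]]; lia.
have [k] := least_power n (isT : 0 < 20).
(* For [k = 0] the inequality reads [20 < 3 * n], which is why [n <= 6] was set apart. *)
move=> nk /orP lt_k; have {lt_k} : 20 * 3 ^ k < 3 * n by case: lt_k => [/eqP->|]; lia.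
move=> lt_k; have := (lb1 2 0 k, lb5 0 0 k, lb20 0 1 k) => -[[]].
have [n9|n9] := leqP n (9 * 3 ^ k).
  by have := (@g1_exp 4 n k.+2, lb1 1 0 k, lb11 0 1 k) => -[[]]; rewrite !expnS; lia.
have [n11|n11] := leqP n (11 * 3 ^ k).
  (* The box of size 10 is for [n = 10] with [k = 0]; in this range a positive [k] gives
     [11 <= n]. *)
  have := (@g1_table 4 n 11 9 k isT, @g1_table 4 n 10 9 k isT, lb11 0 1 k) => -[[]].
  by case: k nk lt_k n9 n11 => [|k]; rewrite ?expnS /=; lia.
have [n15|n15] := leqP n (15 * 3 ^ k).
  by have := (@g1_table 4 n 5 6 k.+1 isT, lb11 0 0 k) => -[]; rewrite !expnS; lia.
(* When [k = 0], sizes 16 to 18 come from the box of size 6 split once, while 19 and 20 have boxes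
   of their own. *)
have := (@g1_table 4 n 20 11 k isT, @g1_table 4 n 19 11 k isT) => -[].
have := (@g1_table 4 n 6 7 k.+1 isT, lb11 0 0 k, lb5 1 0 k) => -[[]].
by case: k nk lt_k n9 n11 n15 => [|k]; rewrite ?expnS /=; lia.
Qed.

(** The same scheme with breakpoints 7, 9, 11 and 13 in units of [3 ^ k]: the five ranges up to 17
    allow [5 * k] plus 9, 10, 11, 12 and 13 weighings. *)
Lemma g1_const5 n x1 x7 x11 x13 x17 : 0 < n ->
  log3_lower_bound n 1 x1 ->
  log3_lower_bound n 7 x7 -> log3_lower_bound n 11 x11 ->
  log3_lower_bound n 13 x13 -> log3_lower_bound n 17 x17 ->
  ((g1_const 5 n)%:Z <= x1 + x7 + x11 + x13 + x17 + 7)%R.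
Proof.
move=> n_gt0 lb1 lb7 lb11 lb13 lb17; have [n5|n5] := ltnP 5 n; last first.
  case: n n_gt0 n5 lb1 lb7 lb11 lb13 lb17 => [|[|[|[|[|[|]]]]]] // _ _ lb1 lb7 lb11 lb13 lb17.
  + have := (@g1_exp 5 1 0 isT, lb1 0 1 0 isT, lb7 0 2 0 isT,
      lb11 0 3 0 isT, lb13 0 3 0 isT, lb17 0 3 0 isT) => -[[[[[]]]]]; lia.
  + have := (@g1_table 5 2 2 4 0 isT isT, lb1 0 0 0 isT, lb7 0 2 0 isT,
      lb11 0 2 0 isT, lb13 0 2 0 isT, lb17 0 2 0 isT) => -[[[[[]]]]]; lia.
  + have := (@g1_exp 5 3 1 isT, lb1 0 0 0 isT, lb7 0 1 0 isT,
      lb11 0 2 0 isT, lb13 0 2 0 isT, lb17 0 2 0 isT) => -[[[[[]]]]]; lia.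
  + have := (@g1_table 5 4 4 7 0 isT isT, lb1 1 0 0 isT, lb7 0 1 0 isT,
      lb11 0 1 0 isT, lb13 0 2 0 isT, lb17 0 2 0 isT) => -[[[[[]]]]]; lia.
  + have := (@g1_table 5 5 5 8 0 isT isT, lb1 1 0 0 isT, lb7 0 1 0 isT,
      lb11 0 1 0 isT, lb13 0 1 0 isT, lb17 0 2 0 isT) => -[[[[[]]]]]; lia.
have [k] := least_power n (isT : 0 < 17).
move=> nk /orP lt_k; have {lt_k} : 17 * 3 ^ k < 3 * n by case: lt_k => [/eqP->|]; lia.
move=> lt_k; have := (lb11 0 1 k, lb13 0 1 k, lb17 0 1 k) => -[[]].
have [n7|n7] := leqP n (7 * 3 ^ k).
  have := (@g1_table 5 n 7 9 k isT, @g1_table 5 n 6 9 k isT, lb1 1 0 k, lb7 0 1 k) => -[[[]]].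
  by case: k nk lt_k n7 => [|k]; rewrite ?expnS /=; lia.
have [n9|n9] := leqP n (9 * 3 ^ k).
  by have := (@g1_exp 5 n k.+2, lb1 1 0 k, lb7 0 0 k) => -[[]]; rewrite !expnS; lia.
have := (lb1 2 0 k, lb7 0 0 k) => -[].
have [n11|n11] := leqP n (11 * 3 ^ k).
  have := (@g1_table 5 n 11 11 k isT, @g1_table 5 n 10 11 k isT) => -[].
  by case: k nk lt_k n7 n9 n11 => [|k]; rewrite ?expnS /=; lia.
have [n13|n13] := leqP n (13 * 3 ^ k).
  (* For [k = 0], size 12 is 3 times 4 and size 13 has its own box. *)
  have := (@g1_table 5 n 13 12 k isT, @g1_table 5 n 4 7 k.+1 isT, lb11 0 0 k) => -[[]].
  by case: k nk lt_k n7 n9 n11 n13 => [|k]; rewrite ?expnS /=; lia.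
(* For [k = 0], sizes 14 and 15 come from the box of size 5 split once, while 16 and 17 have their
   own. *)
have := (@g1_table 5 n 17 13 k isT, @g1_table 5 n 16 13 k isT) => -[].
have := (@g1_table 5 n 5 8 k.+1 isT, lb11 0 0 k, lb13 0 0 k) => -[[]].
by case: k nk lt_k n7 n9 n11 n13 => [|k]; rewrite ?expnS /=; lia.
Qed.


Local Open Scope ring_scope.

Theorem proposition1 (R : realType) (n : nat) (n_gt0 : (0 < n)%N) :
  [/\ (g1_const 2 n)%:Z <=
        Num.ceil (log3 (n%:R : R)) + Num.ceil (log3 (n%:R / 5 : R)) + 1,
      (g1_const 3 n)%:Z <=
        Num.ceil (log3 (n%:R : R)) + Num.ceil (log3 (n%:R / 4 : R))
        + Num.ceil (log3 (n%:R / 6 : R)) + 2,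
      (g1_const 4 n)%:Z <=
        Num.ceil (log3 (n%:R : R)) + Num.ceil (log3 (n%:R / 5 : R))
        + Num.ceil (log3 (n%:R / 11 : R)) + Num.ceil (log3 (n%:R / 20 : R)) + 5
    & (g1_const 5 n)%:Z <=
        Num.ceil (log3 (n%:R : R)) + Num.ceil (log3 (n%:R / 7 : R))
        + Num.ceil (log3 (n%:R / 11 : R)) + Num.ceil (log3 (n%:R / 13 : R))
        + Num.ceil (log3 (n%:R / 17 : R)) + 7].
Proof.
have lb1 : log3_lower_bound n 1 (Num.ceil (log3 (n%:R : R))).
  by have := @ceil_log3_lower_bound R n 1 isT; rewrite divr1.
have lb c := @ceil_log3_lower_bound R n c.
split.
- exact: g1_const2 (lb 5%N isT).
- exact: g1_const3 (lb 4%N isT) (lb 6%N isT).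
- exact: g1_const4 (lb 5%N isT) (lb 11%N isT) (lb 20%N isT).
- exact: g1_const5 (lb 7%N isT) (lb 11%N isT) (lb 13%N isT) (lb 17%N isT).
Qed.
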